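(* Let $n\ge 3$, let $u$ be a positive smooth function on a manifold $M^n$ and let $m$ be a nonzero real constant. (i) If $(M^n,g,\nabla u,-\frac{m}{u},\lambda)$ is a gradient $(-\frac{m}{u})$-Ricci soliton, then there is a constant $\mu\in\mathbb{R}$ such that $$\lambda u^2+u\Delta u+(m-1)|\nabla u|^2=\mu\quad\text{on } M.$$ (ii) If $(M^n,g,\nabla u,-\frac{m}{u},\lambda)$ is a compact gradient $(-\frac{m}{u})$-Ricci soliton which is steady ($\lambda=0$) or expanding ($\lambda<0$), then it is trivial.
   Context: Manifolds are smooth and connected. For a smooth positive function $u$ and a nonzero constant $m$, a gradient $(-\frac{m}{u})$-Ricci soliton $(M^n,g,\nabla u,-\frac{m}{u},\lambda)$ is a complete Riemannian manifold $(M^n,g)$ and a constant $\lambda\in\mathbb{R}$ such that $$Ric-\frac{m}{u}\nabla^2u=\lambda g,$$ where $Ric$ is the Ricci tensor of $g$ and $\nabla^2u$ is the Hessian of $u$. It is called trivial if $\mathcal{L}_{\nabla u}g=c\,g$ for some constant $c\in\mathbb{R}$, where $\mathcal{L}$ is the Lie derivative (so $\mathcal{L}_{\nabla u}g=2\nabla^2u$). $\Delta u=\mathrm{tr}_g\nabla^2u$ is the Laplacian. *)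

(* Defs.v *)
From mathcomp Require Import all_boot all_order all_algebra.
From mathcomp Require Import all_classical all_reals all_analysis.

Set Implicit Arguments.
Unset Strict Implicit.
Unset Printing Implicit Defensive.

Import Order.TTheory GRing.Theory Num.Theory.
Import numFieldNormedType.Exports.

Local Open Scope classical_set_scope.
Local Open Scope ring_scope.

Definition basis_vec (R : realType) (n : nat) (i : 'I_n) : 'rV[R]_n :=
  delta_mx 0 i.

Definition partial (R : realType) (n : nat) (i : 'I_n) (f : 'rV[R]_n -> R) :
    'rV[R]_n -> R :=
  fun x => 'D_(basis_vec R i) f x.

Definition iter_partial (R : realType) (n : nat) (s : seq 'I_n)
    (f : 'rV[R]_n -> R) : 'rV[R]_n -> R :=
  foldr (fun i h => partial i h) f s.

(* C^oo on an open set U: all iterated partial derivatives exist and are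
   continuous on U.  Derivatives are local, so the values of f outside the
   open set U are irrelevant. *)
Definition smooth_on (R : realType) (n : nat) (U : set 'rV[R]_n)
    (f : 'rV[R]_n -> R) : Prop :=
  forall (s : seq 'I_n) (x : 'rV[R]_n), U x ->
    {for x, continuous (iter_partial s f)} /\
    forall i : 'I_n, derivable (iter_partial s f) x (basis_vec R i).

(** Tensor calculus in a coordinate domain of R^n.  The metric is given by
    its matrix of components [g x = (g_ij(x))]; a vector field is given by
    its row [X x = (X^1(x), ..., X^n(x))]. *)

(* Gamma^k_ij = 1/2 g^kl (d_i g_jl + d_j g_il - d_l g_ij) *)
Definition christoffel (R : realType) (n : nat) (g : 'rV[R]_n -> 'M[R]_n)
    (k i j : 'I_n) (x : 'rV[R]_n) : R :=
  2^-1 * \sum_(l < n) invmx (g x) k l *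
    (partial i (fun y => g y j l) x + partial j (fun y => g y i l) x
     - partial l (fun y => g y i j) x).

(* The l-th component of R(d_i, d_j) d_k, where
   R(X, Y) Z = D_X D_Y Z - D_Y D_X Z - D_[X, Y] Z
   for the Levi-Civita connection D. *)
Definition riemann (R : realType) (n : nat) (g : 'rV[R]_n -> 'M[R]_n)
    (l i j k : 'I_n) (x : 'rV[R]_n) : R :=
  partial i (christoffel g l j k) x - partial j (christoffel g l i k) x
  + \sum_(p < n) (christoffel g l i p x * christoffel g p j k x
                  - christoffel g l j p x * christoffel g p i k x).

(* Ric(Y, Z) = tr (X |-> R(X, Y) Z); positive on round spheres. *)
Definition ricci (R : realType) (n : nat) (g : 'rV[R]_n -> 'M[R]_n)
    (x : 'rV[R]_n) : 'M[R]_n :=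
  \matrix_(j < n, k < n) \sum_(i < n) riemann g i i j k x.

Definition hessian (R : realType) (n : nat) (g : 'rV[R]_n -> 'M[R]_n)
    (f : 'rV[R]_n -> R) (x : 'rV[R]_n) : 'M[R]_n :=
  \matrix_(i < n, j < n)
    (partial i (partial j f) x
     - \sum_(k < n) christoffel g k i j x * partial k f x).

Definition laplacian (R : realType) (n : nat) (g : 'rV[R]_n -> 'M[R]_n)
    (f : 'rV[R]_n -> R) (x : 'rV[R]_n) : R :=
  \sum_(i < n) \sum_(j < n) invmx (g x) i j * hessian g f x i j.

Definition gradient (R : realType) (n : nat) (g : 'rV[R]_n -> 'M[R]_n)
    (f : 'rV[R]_n -> R) (x : 'rV[R]_n) : 'rV[R]_n :=
  \row_(k < n) \sum_(l < n) invmx (g x) k l * partial l f x.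

Definition sqnorm (R : realType) (n : nat) (g : 'rV[R]_n -> 'M[R]_n)
    (X : 'rV[R]_n -> 'rV[R]_n) (x : 'rV[R]_n) : R :=
  \sum_(i < n) \sum_(j < n) g x i j * X x 0 i * X x 0 j.

(* (L_X g)_ij = X^k d_k g_ij + g_kj d_i X^k + g_ik d_j X^k *)
Definition lie_metric (R : realType) (n : nat) (g : 'rV[R]_n -> 'M[R]_n)
    (X : 'rV[R]_n -> 'rV[R]_n) (x : 'rV[R]_n) : 'M[R]_n :=
  \matrix_(i < n, j < n) \sum_(k < n)
    (X x 0 k * partial k (fun y => g y i j) x
     + g x k j * partial i (fun y => X y 0 k) x
     + g x i k * partial j (fun y => X y 0 k) x).

(* Homeomorphism between an open set of M and an open set of R^n; both maps
   are totalized, with irrelevant values outside [dom] and [cod]. *)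
Record chart (R : realType) (n : nat) (M : topologicalType) := Chart {
  dom : set M;
  cod : set 'rV[R]_n;
  coord : M -> 'rV[R]_n;
  param : 'rV[R]_n -> M;
  open_dom : open dom;
  open_cod : open cod;
  coordP : forall p, dom p -> cod (coord p);
  paramP : forall x, cod x -> dom (param x);
  coordK : forall p, dom p -> param (coord p) = p;
  paramK : forall x, cod x -> coord (param x) = x;
  coord_continuous : {within dom, continuous coord};
  param_continuous : {within cod, continuous param}
}.

Definition transition (R : realType) (n : nat) (M : topologicalType)
    (a b : chart R n M) : 'rV[R]_n -> 'rV[R]_n :=
  fun x => coord b (param a x).

Definition overlap (R : realType) (n : nat) (M : topologicalType)
    (a b : chart R n M) : set 'rV[R]_n :=
  [set x | cod a x /\ dom b (param a x)].

(* J_ik = d_i tau^k, tau being the transition map from a to b *)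
Definition jacobian_mx (R : realType) (n : nat) (M : topologicalType)
    (a b : chart R n M) (x : 'rV[R]_n) : 'M[R]_n :=
  \matrix_(i < n, k < n) partial i (fun y => transition a b y 0 k) x.

(* Connected smooth n-manifold without boundary.  The smooth structure is
   given by an indexed smooth atlas, not required to be maximal. *)
Record smooth_manifold (R : realType) (n : nat) := SmoothManifold {
  space :> topologicalType;
  space_hausdorff : hausdorff_space space;
  space_second_countable : @second_countable space;
  space_connected : connected [set: space];
  atlas : Type;
  chart_of : atlas -> chart R n space;
  atlas_cover : forall p : space, exists a, dom (chart_of a) p;
  atlas_smooth : forall (a b : atlas) (k : 'I_n),
    smooth_on (overlap (chart_of a) (chart_of b))
      (fun x => transition (chart_of a) (chart_of b) x 0 k)
}.

(* A smooth positive definite symmetric (0,2)-tensor field, given by its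
   components in every chart; [metric_change] is the covariant
   transformation law g_ij = d_i tau^k  g'_kl  d_j tau^l. *)
Record riemannian_metric (R : realType) (n : nat) (M : smooth_manifold R n) :=
  RiemannianMetric {
  comp :> atlas M -> 'rV[R]_n -> 'M[R]_n;
  metric_smooth : forall a i j,
    smooth_on (cod (chart_of a)) (fun x => comp a x i j);
  metric_sym : forall a x, cod (chart_of a) x -> (comp a x)^T = comp a x;
  metric_posdef : forall a x, cod (chart_of a) x ->
    forall v : 'rV[R]_n, v != 0 -> 0 < (v *m comp a x *m v^T) 0 0;
  metric_change : forall a b x, overlap (chart_of a) (chart_of b) x ->
    comp a x = jacobian_mx (chart_of a) (chart_of b) x
      *m comp b (transition (chart_of a) (chart_of b) x)
      *m (jacobian_mx (chart_of a) (chart_of b) x)^T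
}.

Definition local_rep (R : realType) (n : nat) (M : smooth_manifold R n)
    (a : atlas M) (f : M -> R) : 'rV[R]_n -> R :=
  fun x => f (param (chart_of a) x).

Definition smooth_fun (R : realType) (n : nat) (M : smooth_manifold R n)
    (f : M -> R) : Prop :=
  forall a : atlas M, smooth_on (cod (chart_of a)) (local_rep a f).

Definition curve_rep (R : realType) (n : nat) (M : smooth_manifold R n)
    (a : atlas M) (c : R -> M) (k : 'I_n) : R -> R :=
  fun t => coord (chart_of a) (c t) 0 k.

Definition geodesic (R : realType) (n : nat) (M : smooth_manifold R n)
    (g : riemannian_metric M) (c : R -> M) : Prop :=
  continuous c /\
  forall (t : R) (a : atlas M), dom (chart_of a) (c t) ->
    forall k : 'I_n,
      derivable (curve_rep a c k) t 1 /\
      derivable (derive1 (curve_rep a c k)) t 1 /\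
      derive1 (derive1 (curve_rep a c k)) t
      + \sum_(i < n) \sum_(j < n)
          christoffel (g a) k i j (coord (chart_of a) (c t))
          * derive1 (curve_rep a c i) t * derive1 (curve_rep a c j) t = 0.

(* Geodesic completeness: exp_p is defined on all of T_p M for every p, i.e.
   every initial velocity is that of a geodesic defined on the whole line. *)
Definition complete_metric (R : realType) (n : nat) (M : smooth_manifold R n)
    (g : riemannian_metric M) : Prop :=
  forall (a : atlas M) (p : M) (v : 'rV[R]_n), dom (chart_of a) p ->
    exists c : R -> M,
      [/\ geodesic g c, c 0 = p
        & forall k : 'I_n, derive1 (curve_rep a c k) 0 = v 0 k].

(* Equality of (0,2)-tensors is equality of components in every chart. *)
Record gradient_soliton (R : realType) (n : nat) (M : smooth_manifold R n)
    (g : riemannian_metric M) (u : M -> R) (m lambda : R) : Prop :=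
  GradientSoliton {
  soliton_complete : complete_metric g;
  soliton_eq : forall (a : atlas M) (p : M), dom (chart_of a) p ->
    let x := coord (chart_of a) p in
    ricci (g a) x - (m / u p) *: hessian (g a) (local_rep a u) x
    = lambda *: g a x
}.

Definition trivial_soliton (R : realType) (n : nat) (M : smooth_manifold R n)
    (g : riemannian_metric M) (u : M -> R) : Prop :=
  exists c : R, forall (a : atlas M) (p : M), dom (chart_of a) p ->
    let x := coord (chart_of a) p in
    lie_metric (g a) (gradient (g a) (local_rep a u)) x = c *: g a x.

(* Values at p computed in the chart a around p; they do not depend on the
   choice of a, since the formulas are tensorial. *)
Definition laplacian_at (R : realType) (n : nat) (M : smooth_manifold R n)
    (g : riemannian_metric M) (u : M -> R) (a : atlas M) (p : M) : R :=
  laplacian (g a) (local_rep a u) (coord (chart_of a) p).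

Definition gradient_sqnorm_at (R : realType) (n : nat)
    (M : smooth_manifold R n) (g : riemannian_metric M) (u : M -> R)
    (a : atlas M) (p : M) : R :=
  sqnorm (g a) (gradient (g a) (local_rep a u)) (coord (chart_of a) p).

(* Main.v *)
Require Import Defs.
From HB Require Import structures.
From mathcomp Require Import all_boot all_order all_algebra.
From mathcomp Require Import all_classical all_reals all_analysis.
From mathcomp Require Import ring lra.
Import Order.TTheory GRing.Theory Num.Theory.
Import numFieldNormedType.Exports.
Local Open Scope classical_set_scope.
Local Open Scope ring_scope.
Set Implicit Arguments. Unset Strict Implicit. Unset Printing Implicit Defensive.

(** The first integral.  Two classical identities carry it: the contracted
    second Bianchi identity 2 div Ric = d(tr Ric) ([contracted_bianchi]), and
    div (Hess u) = Ric(grad u) + d(Lap u) ([div_hess]), which comes from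
    commuting two covariant derivatives of du.  Inserting the soliton equation
    Ric = lambda g + (m/u) Hess u into the first, using the second, and
    multiplying by u^2/m, one finds exactly that the differential of
      lambda u^2 + u Lap u + (m-1) |grad u|^2
    vanishes ([soliton_first_integral]).  Both identities only use the Leibniz
    rule and the symmetry of second derivatives, so they are proved in an
    arbitrary commutative ring with commuting derivations; connection and
    curvature are matrices over that ring, and the Bianchi identity is an
    identity between non-commutative polynomials in them.  The smooth functions
    on a coordinate domain form such a ring ([smooth_fn]), which makes the
    expression locally constant in each chart ([first_integral_closed]).  Its
    value at a point does not depend on the chart because the Hessian is a
    tensor ([hess_change]), so connectedness makes it a constant mu.

    Triviality.  Put L h = u Lap h + (m-1) <grad u, grad h>, a linear elliptic
    operator without term of order zero, so that the first integral reads
    L u = mu - lambda u^2.  At a maximum of u the left side is at most 0, hence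
    mu <= lambda (max u)^2; as lambda <= 0 and 0 < u <= max u, this gives
    L u <= lambda ((max u)^2 - u^2) <= 0 everywhere.  By the strong maximum
    principle of Hopf ([strong_maximum]), applied to -u, the function u is
    constant near each point where it attains its minimum.  The set of these
    points is open and closed, so u is constant and its Hessian vanishes. *)

(** * Levi-Civita calculus in a ring with commuting derivations *)

Section DifferentialRing.
Variables (F : comNzRingType) (n : nat) (d : 'I_n -> {additive F -> F}).
Hypothesis dM : forall i x y, d i (x * y) = d i x * y + x * d i y.
Hypothesis dC : forall i j x, d i (d j x) = d j (d i x).

Local Notation dm i A := (map_mx (d i) A).

Lemma mxDE p q (A B : 'M[F]_(p, q)) i j : (A + B) i j = A i j + B i j.
Proof. by rewrite mxE. Qed.

Lemma mxNE p q (A : 'M[F]_(p, q)) i j : (- A) i j = - A i j.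
Proof. by rewrite mxE. Qed.

Lemma mxME p q r (A : 'M[F]_(p, q)) (B : 'M[F]_(q, r)) i j :
  (A *m B) i j = \sum_k A i k * B k j.
Proof. by rewrite mxE. Qed.

Lemma mxZE p q a (A : 'M[F]_(p, q)) i j : (a *: A) i j = a * A i j.
Proof. by rewrite mxE. Qed.

Lemma mx0E p q i j : (0 : 'M[F]_(p, q)) i j = 0.
Proof. by rewrite mxE. Qed.

Definition mxDNE := (mxDE, mxNE).

Let lin3 (a b c x : F) : a = 0 -> b = 0 -> c = 0 -> x = a + b + c -> x = 0.
Proof. by move=> -> -> -> ->; rewrite !addr0. Qed.

Ltac mxabel := apply/matrixP => ? ?; rewrite !mxDNE; ring.

Lemma dmM i p q r (A : 'M[F]_(p, q)) (B : 'M[F]_(q, r)) :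
  dm i (A *m B) = dm i A *m B + A *m dm i B.
Proof.
apply/matrixP => a b; rewrite !mxE raddf_sum -big_split; apply: eq_bigr => k _.
by rewrite dM !mxE.
Qed.

Lemma dmC i j p q (A : 'M[F]_(p, q)) : dm i (dm j A) = dm j (dm i A).
Proof. by apply/matrixP => a b; rewrite !mxE dC. Qed.

Lemma dmZ i p q a (A : 'M[F]_(p, q)) : dm i (a *: A) = d i a *: A + a *: dm i A.
Proof. by apply/matrixP => b c; rewrite !mxE dM. Qed.

Lemma d1 i : d i 1 = 0.
Proof.
by have /eqP := dM i 1 1; rewrite !mulr1 mul1r -subr_eq subrr eq_sym => /eqP.
Qed.

Lemma dm1 i : dm i (1%:M : 'M[F]_n) = 0.
Proof. by apply/matrixP => a b; rewrite !mxE raddfMn d1 mul0rn. Qed.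

Lemma d_trace i (A : 'M[F]_n) : d i (\tr A) = \tr (dm i A).
Proof. by rewrite /mxtrace raddf_sum; apply: eq_bigr => k _; rewrite mxE. Qed.

Variables (G H : 'M[F]_n) (half : F).
Hypotheses (Gsym : G^T = G) (HG : H *m G = 1%:M) (half2 : half + half = 1).

(** The Christoffel symbols with the upper index lowered. *)
Definition lowered i : 'M[F]_n :=
  \matrix_(l, j) (half * (d i (G j l) + d j (G i l) - d l (G i j))).

(** The connection matrix in the direction i: its entry (k, j) is the
    Christoffel symbol with upper index k and lower indices i, j.  Row and
    column are frame indices, i is a form index. *)
Definition conn i : 'M[F]_n := \matrix_(k, j)
  (half * \sum_l H k l * (d i (G j l) + d j (G i l) - d l (G i j))).

Local Notation A := conn.

Lemma connE i : A i = H *m lowered i.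
Proof.
apply/matrixP => k j; rewrite !mxE mulr_sumr; apply: eq_bigr => l _.
rewrite mxE; ring.
Qed.

Let GE i j : G i j = G j i. Proof. by rewrite -{1}Gsym mxE. Qed.

Lemma Hsym : H^T = H.
Proof.
have GHt : G *m H^T = 1%:M by rewrite -{1}Gsym -trmx_mul HG trmx1.
by rewrite -[LHS]mul1mx -HG -mulmxA GHt mulmx1.
Qed.

Let HE i j : H i j = H j i. Proof. by rewrite -{1}Hsym mxE. Qed.

Lemma connC i j k : A i k j = A j k i.
Proof.
rewrite !mxE; congr (_ * _); apply: eq_bigr => l _; rewrite (GE j i); ring.
Qed.

(** The Levi-Civita connection is metric: symmetrizing the Koszul formula in
    the two frame indices cancels all derivatives of G but one. *)
Lemma dG i : dm i G = (A i)^T *m G + G *m A i.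
Proof.
have GA : G *m A i = lowered i by rewrite connE mulmxA (mulmx1C HG) mul1mx.
have -> : (A i)^T *m G = (lowered i)^T by rewrite -GA [RHS]trmx_mul Gsym.
rewrite GA; apply/matrixP => l j; rewrite !mxE (GE j l).
rewrite -mulrDr; move: (d i _) (d j _) (d l _) => X Y Z.
transitivity ((half + half) * X); first by rewrite half2 mul1r.
ring.
Qed.

Lemma dH i : dm i H = - (A i *m H) - H *m (A i)^T.
Proof.
have := dm1 i; rewrite -{1}HG dmM dG => /(congr1 (fun X => X *m H)).
rewrite mul0mx mulmxDl -mulmxA (mulmx1C HG) mulmx1 mulmxDr mulmxDl.
rewrite -!mulmxA (mulmx1C HG) mulmx1 [H *m (G *m _)]mulmxA HG mul1mx.
by move=> /eqP; rewrite addr_eq0 => /eqP ->; rewrite opprD addrC.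
Qed.

Definition curv i j : 'M[F]_n :=
  dm i (A j) - dm j (A i) + A i *m A j - A j *m A i.

Lemma curvC i j : curv i j = - curv j i.
Proof. rewrite /curv; mxabel. Qed.

(** The curvature is skew with respect to the metric.  Differentiating
    [dH] once more expresses both mixed second derivatives of H; since they are
    equal, the curvature terms cancel in pairs. *)
Lemma curv_skew i j : curv i j *m H + H *m (curv i j)^T = 0.
Proof.
have := dmC i j H; rewrite !dH !(raddfB, raddfN) /= !dmM -!map_trmx !dH.
rewrite /curv !(raddfD, raddfN) /= !trmx_mul.
rewrite !(mulmxDl, mulmxDr, mulmxBl, mulmxBr, mulNmx, mulmxN) !mulmxA.
rewrite ?map_trmx => /matrixP E; apply/matrixP => a b.
move/(_ a b)/eqP: E; rewrite !mxDNE -subr_eq0 => /eqP E; rewrite [RHS]mxE.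
by apply: oppr_inj; rewrite oppr0 -E; ring.
Qed.

(** Covariant derivative of the curvature as an endomorphism-valued form: only
    the two frame indices are corrected by the connection. *)
Definition gcurv l i j : 'M[F]_n :=
  dm l (curv i j) + A l *m curv i j - curv i j *m A l.

(** Skewness is preserved because H is parallel: the identity is the covariant
    derivative of [curv_skew]. *)
Lemma gcurv_skew l i j : gcurv l i j *m H + H *m (gcurv l i j)^T = 0.
Proof.
have R0 := curv_skew i j.
have := congr1 (fun X => dm l X) R0; rewrite map_mx0 raddfD /= !dmM -map_trmx dH.
have E1 := congr1 (fun X => A l *m X) R0.
have E2 := congr1 (fun X => X *m (A l)^T) R0.
move: E1 E2; rewrite /gcurv; move: (curv i j) => X.
rewrite !(raddfD, raddfN) /= !trmx_mul mulmx0 mul0mx map_trmx.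
rewrite !(mulmxDl, mulmxDr, mulmxBl, mulmxBr, mulNmx, mulmxN) !mulmxA.
move=> /matrixP E1 /matrixP E2 /matrixP E; apply/matrixP => a b.
have := E a b; have := E1 a b; have := E2 a b; rewrite !mxDNE.
rewrite !mx0E.
move=> e2 e1 e0; apply: (lin3 e0 e1 e2); ring.
Qed.

(** Second Bianchi identity.  It holds for any connection: in the cyclic sum the
    second derivatives of the connection matrices cancel by [dmC], and their
    products cancel formally. *)
Lemma gcurv_cyc k i j : gcurv k i j + gcurv i j k + gcurv j k i = 0.
Proof.
rewrite /gcurv /curv.
rewrite !(raddfD, raddfN) /= !dmM.
rewrite (dmC k i) (dmC i j) (dmC k j).
rewrite !(mulmxDl, mulmxDr, mulmxBl, mulmxBr, mulNmx, mulmxN) !mulmxA.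
apply/matrixP => a b; rewrite !mxDNE [RHS]mxE; ring.
Qed.

Lemma gcurvC l i j : gcurv l i j = - gcurv l j i.
Proof.
rewrite /gcurv (curvC i j) raddfN /= mulmxN mulNmx; mxabel.
Qed.

(* Correction of one form index of the curvature by the connection. *)
Let tc k i j : 'M[F]_n := \sum_p A k p i *: curv p j.

Let tcC k i j : tc k i j = tc i k j.
Proof. by apply: eq_bigr => p _; rewrite connC. Qed.

(** The full covariant derivative.  Antisymmetry of the curvature in its form
    indices turns the correction of the second one into the last term. *)
Definition covcurv k i j := gcurv k i j - tc k i j + tc k j i.

Lemma covcurvC l i j : covcurv l i j = - covcurv l j i.
Proof. rewrite /covcurv gcurvC; mxabel. Qed.

(** Because the connection has no torsion, correcting the two form indices adds
    nothing to the cyclic sum. *)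
Lemma covcurv_cyc k i j : covcurv k i j + covcurv i j k + covcurv j k i = 0.
Proof.
rewrite -(gcurv_cyc k i j) /covcurv (tcC k i) (tcC k j) (tcC i j); mxabel.
Qed.

Lemma covcurv_skew l i j : covcurv l i j *m H + H *m (covcurv l i j)^T = 0.
Proof.
have t0 a b : tc l a b *m H + H *m (tc l a b)^T = 0.
  rewrite /tc raddf_sum mulmx_suml mulmx_sumr -big_split big1 // => p _.
  by rewrite /= linearZ /= -scalemxAl -scalemxAr -scalerDr curv_skew scaler0.
move: (t0 i j) (t0 j i) (gcurv_skew l i j); rewrite /covcurv.
move: (tc l i j) (tc l j i) (gcurv l i j) => X Y Z /matrixP E1 /matrixP E2 /matrixP E.
rewrite !(raddfD, raddfN) /= !(mulmxDl, mulmxDr, mulNmx, mulmxN).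
apply/matrixP => a b; move: (E1 a b) (E2 a b) (E a b).
rewrite !mxDNE; rewrite !mx0E.
move=> /(congr1 -%R); rewrite oppr0 => e1 e2 e; apply: (lin3 e e1 e2); ring.
Qed.

Definition ric : 'M[F]_n := \matrix_(j, k) \sum_i curv i j i k.

(** Covariant derivative of a bilinear form in the direction k. *)
Definition covbil k (S : 'M[F]_n) : 'M[F]_n := dm k S - (A k)^T *m S - S *m A k.

Lemma covbil_G k : covbil k G = 0.
Proof. by rewrite /covbil dG -addrA -opprD subrr. Qed.

Lemma trace_covbil k S : d k (\tr (S *m H)) = \tr (covbil k S *m H).
Proof.
rewrite d_trace dmM dH /covbil !(mulmxBl, mulmxDr, mulmxN) !raddfD !raddfN /=.
rewrite -!mulmxA [\tr ((A k)^T *m _)]mxtrace_mulC -!mulmxA; ring.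
Qed.

(** Taking the Ricci trace commutes with covariant differentiation: the
    connection terms of the contracted form index and of the contracted frame
    index cancel. *)
Lemma covcurv_trace i j q : \sum_l covcurv i l j l q = covbil i ric j q.
Proof.
rewrite /covbil !mxDNE !mxME.
under eq_bigr => l _ do rewrite /covcurv /gcurv /tc !mxDNE !mxME !summxE.
rewrite !big_split /= !sumrN.
have -> : \sum_l map_mx (d i) (curv l j) l q = map_mx (d i) ric j q.
  rewrite [RHS]mxE [ric j q]mxE raddf_sum; apply: eq_bigr => l _.
  by rewrite [LHS]mxE.
have -> : \sum_l \sum_k A i l k * curv l j k q =
          \sum_l \sum_k (A i k l *: curv k j) l q.
  rewrite exchange_big; apply: eq_bigr => l _; apply: eq_bigr => k _.
  by rewrite [RHS]mxE.
have -> : \sum_l \sum_k curv l j l k * A i k q = \sum_k ric j k * A i k q.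
  rewrite exchange_big; apply: eq_bigr => k _.
  by rewrite [ric j k]mxE mulr_suml.
have -> : \sum_l \sum_k (A i k j *: curv k l) l q =
          - \sum_k (A i)^T j k * ric k q.
  rewrite exchange_big -sumrN; apply: eq_bigr => k _.
  rewrite [ric k q]mxE [(A i)^T j k]mxE mulr_sumr -sumrN.
  by apply: eq_bigr => l _; rewrite curvC scalerN mxNE mxZE.
ring.
Qed.

(** For a tensor with the two antisymmetries of the curvature, the metric
    contraction of a form index with a frame index is again a Ricci trace.  This replaces the
    pair symmetry of the curvature tensor in both contractions below. *)
Lemma skew_trace (X : 'I_n -> 'I_n -> 'M[F]_n) i l :
    (forall j k, X j k = - X k j) ->
    (forall j k, X j k *m H + H *m (X j k)^T = 0) ->
  \sum_j \sum_q X i j l q * H q j = \sum_p H l p * \sum_j X j i j p.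
Proof.
move=> XC XH.
transitivity (- \sum_j (H *m (X i j)^T) l j).
  rewrite -sumrN; apply: eq_bigr => j _; apply/eqP; rewrite -addr_eq0.
  have /matrixP/(_ l j)/eqP := XH i j; rewrite mxDE mx0E.
  by rewrite [(X i j *m H) l j]mxE.
under eq_bigr => j _ do rewrite mxE.
rewrite exchange_big -sumrN; apply: eq_bigr => p _ /=.
rewrite mulr_sumr -sumrN; apply: eq_bigr => j _.
by rewrite XC !mxE mulrN opprK.
Qed.

Definition divergence S i := \sum_l \sum_p H l p * covbil l S i p.

(** Contract the second Bianchi identity once with the trace and once with H.
    Two of the three cyclic terms become the divergence of the Ricci tensor
    ([e1] through [skew_trace], [e3] directly), the remaining one is minus the
    differential of the scalar curvature ([e2]). *)
Theorem contracted_bianchi i : d i (\tr (ric *m H)) = divergence ric i + divergence ric i.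
Proof.
have e1 : \sum_l \sum_j \sum_q covcurv l i j l q * H q j = divergence ric i.
  apply: eq_bigr => l _; rewrite skew_trace; first last.
  - exact: covcurv_skew.
  - exact: covcurvC.
  by apply: eq_bigr => p _; rewrite covcurv_trace.
have e2 : \sum_l \sum_j \sum_q covcurv i j l l q * H q j =
          - d i (\tr (ric *m H)).
  rewrite trace_covbil /mxtrace exchange_big -sumrN; apply: eq_bigr => j _ /=.
  rewrite exchange_big mxE -sumrN; apply: eq_bigr => q _ /=.
  rewrite -covcurv_trace mulr_suml -sumrN; apply: eq_bigr => l _.
  by rewrite covcurvC !mxE mulNr.
have e3 : \sum_l \sum_j \sum_q covcurv j l i l q * H q j = divergence ric i.
  rewrite exchange_big; apply: eq_bigr => j _ /=.
  rewrite exchange_big; apply: eq_bigr => q _ /=.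
  by rewrite -covcurv_trace mulr_sumr; apply: eq_bigr => l _; rewrite HE mulrC.
apply/eqP; rewrite -subr_eq0 -oppr_eq0 opprB -addrA -{1}e1 -{1}e3 -e2.
rewrite -!big_split big1 // => l _ /=; rewrite -!big_split big1 // => j _ /=.
rewrite -!big_split big1 // => q _ /=; rewrite -!mulrDl.
have /matrixP/(_ l q) := covcurv_cyc l i j; rewrite !mxDNE mx0E => e.
by rewrite [X in X * _](_ : _ = 0) ?mul0r // -e; ring.
Qed.

Section Hessian.
Variable u : F.

Definition du : 'rV[F]_n := \row_i d i u.

Definition hess : 'M[F]_n :=
  \matrix_(i, j) (d i (d j u) - \sum_k A i k j * d k u).

Lemma row_hess i : row i hess = dm i du - du *m A i.
Proof.
apply/rowP => j; rewrite !mxE; congr (_ - _).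
by apply: eq_bigr => k _; rewrite !mxE mulrC.
Qed.

(** Ricci identity: the two orders of differentiating du covariantly differ by
    the curvature.  The correction of the form index is symmetric in k and i and
    drops out. *)
Lemma ricci_identity k i p :
  covbil k hess i p - covbil i hess k p = - (du *m curv k i) 0 p.
Proof.
have rowE j l : row j (covbil l hess) =
    dm l (row j hess) - \sum_q A l q j *: row q hess - row j hess *m A l.
  rewrite /covbil !raddfB /= -row_mul -map_row; congr (_ - _ - _).
  apply/rowP => s; rewrite !mxE summxE; apply: eq_bigr => q _.
  by rewrite !mxE.
have -> (S T : 'M[F]_n) : S i p - T k p = (row i S - row k T) 0 p.
  by rewrite !mxE.
rewrite !rowE; under [in X in _ - X]eq_bigr => q _ do rewrite connC.
set X := \sum_q _; rewrite !row_hess !raddfB /= !dmM dmC /curv.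
rewrite !(mulmxDl, mulmxDr, mulmxBl, mulmxBr, mulNmx, mulmxN) !mulmxA.
rewrite !mxDNE; ring.
Qed.

Definition lap : F := \tr (hess *m H).

(** Bochner: exchange the divergence index with i by the Ricci identity, then
    contract; the curvature term is a Ricci trace by [skew_trace]. *)
Theorem div_hess i :
  divergence hess i = d i lap + \sum_l d l u * \sum_p H l p * ric i p.
Proof.
transitivity (\sum_l \sum_p H l p * (covbil i hess l p - (du *m curv l i) 0 p)).
  do 2!(apply: eq_bigr => ? _); rewrite -ricci_identity; ring.
under eq_bigr => l _ do (under eq_bigr => p _ do rewrite mulrBr; rewrite sumrB).
rewrite sumrB; congr (_ + _).
  rewrite /lap trace_covbil; apply: eq_bigr => l _; rewrite mxE.
  by apply: eq_bigr => p _; rewrite HE mulrC.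
transitivity (\sum_l d l u * \sum_j \sum_q curv i j l q * H q j).
  rewrite -sumrN; under [RHS]eq_bigr => l _ do rewrite mulr_sumr.
  rewrite exchange_big; apply: eq_bigr => j _ /=; rewrite -sumrN.
  under [RHS]eq_bigr => l _ do rewrite mulr_sumr.
  rewrite exchange_big; apply: eq_bigr => q _ /=.
  rewrite mxE mulr_sumr -sumrN; apply: eq_bigr => l _.
  by rewrite curvC !mxE HE; ring.
apply: eq_bigr => l _; congr (_ * _); rewrite skew_trace.
- by apply: eq_bigr => p _; rewrite mxE.
- exact: curvC.
- exact: curv_skew.
Qed.

Definition gradsq : F := \sum_l \sum_p H l p * d l u * d p u.

Definition hess_grad i : F := \sum_l \sum_p H l p * d l u * hess i p.

(** The squared gradient is the trace of the rank-one form du^T du, whose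
    covariant derivative is a symmetrized product of du with a row of the
    Hessian. *)
Lemma d_gradsq i : d i gradsq = hess_grad i + hess_grad i.
Proof.
have gE : gradsq = \tr (du^T *m du *m H).
  rewrite /gradsq /mxtrace; apply: eq_bigr => l _; rewrite mxE.
  apply: eq_bigr => p _; rewrite !mxE big_ord1 !mxE (HE l p); ring.
have cE : covbil i (du^T *m du) = (row i hess)^T *m du + du^T *m row i hess.
  rewrite /covbil dmM -map_trmx row_hess !(raddfD, raddfN) /= trmx_mul.
  rewrite !(mulmxDl, mulmxDr, mulmxBl, mulmxBr, mulNmx, mulmxN) !mulmxA.
  mxabel.
rewrite gE trace_covbil cE mulmxDl raddfD /=; congr (_ + _).
  rewrite /mxtrace /hess_grad exchange_big; apply: eq_bigr => l _; rewrite mxE.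
  by apply: eq_bigr => p _; rewrite !mxE big_ord1 !mxE; ring.
rewrite /mxtrace /hess_grad; apply: eq_bigr => l _; rewrite mxE.
by apply: eq_bigr => p _; rewrite !mxE big_ord1 !mxE HE; ring.
Qed.

(** The inverses v of u and minv of m are data, since the ring need not have
    inverses. *)
Theorem soliton_first_integral (v m minv lambda : F) :
    u * v = 1 -> m * minv = 1 ->
    (forall i, d i m = 0) -> (forall i, d i lambda = 0) ->
    ric = lambda *: G + (m * v) *: hess ->
  forall i, d i (lambda * u ^+ 2 + u * lap + (m - 1) * gradsq) = 0.
Proof.
move=> uv mm dm0 dl0 ricE i.
have dv j : d j v = - (v * v * d j u).
  have := d1 j; rewrite -uv dM => /(congr1 ( *%R v)); rewrite mulr0 mulrDr.
  rewrite [v * (u * _)]mulrA [v * u]mulrC uv mul1r => /eqP.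
  by rewrite addrC addr_eq0 => /eqP ->; ring.
have covE l : covbil l ric = m *: (d l v *: hess + v *: covbil l hess).
  have := covbil_G l; rewrite {1}/covbil => cG.
  rewrite ricE /covbil raddfD /= !dmZ dl0 dM dm0.
  rewrite !(mulmxDl, mulmxDr) -!scalemxAr -!scalemxAl.
  move/matrixP: cG => cG; apply/matrixP => a b; have := cG a b.
  rewrite !(mxDNE, mxZE) mx0E => /(congr1 ( *%R lambda)); rewrite mulr0 => e.
  apply/eqP; rewrite -subr_eq0; apply/eqP.
  apply: (lin3 e (erefl 0) (erefl 0)); ring.
have divE : divergence ric i = m * (v * divergence hess i - v * v * hess_grad i).
  rewrite /divergence /hess_grad !mulr_sumr -sumrB mulr_sumr; apply: eq_bigr => l _.
  rewrite !mulr_sumr -sumrB mulr_sumr; apply: eq_bigr => p _.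
  rewrite covE !(mxDNE, mxZE) dv; ring.
have ricuE : \sum_l d l u * (\sum_p H l p * ric i p) =
             lambda * d i u + m * v * hess_grad i.
  rewrite ricE; under eq_bigr => l _.
    under eq_bigr => p _ do rewrite mxDE !mxZE mulrDr.
    rewrite big_split /= mulrDr; over.
  rewrite big_split /=; congr (_ + _).
    transitivity (\sum_l d l u * (lambda * (H *m G) l i)).
      apply: eq_bigr => l _; rewrite mxE mulr_sumr; congr (_ * _).
      by apply: eq_bigr => p _; rewrite GE; ring.
    rewrite HG (bigD1 i) //= big1 ?addr0 => [|j /negPf ji].
      by rewrite mxE eqxx mulr1 mulrC.
    by rewrite mxE ji !mulr0.
  rewrite mulr_sumr; apply: eq_bigr => l _; rewrite !mulr_sumr.
  by apply: eq_bigr => p _; rewrite -/hess !mxE; ring.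
have SE : \tr (ric *m H) = lambda * n%:R + m * v * lap.
  rewrite ricE mulmxDl -!scalemxAl (mulmx1C HG) raddfD /= !mxtraceZ.
  by rewrite mxtrace1.
have := contracted_bianchi i; rewrite SE raddfD /= !dM dl0 raddfMn d1 mul0rn.
rewrite dm0 divE div_hess ricuE dv.
move=> /(congr1 (fun x => minv * u * u * x)) /= E.
rewrite !(raddfD, raddfB) /= !dM !raddfB /= dm0 d1 dl0 d_gradsq.
move: E; move: (d i u) (d i lap) (hess_grad i) => w D N; move: lap => L E.
(* Multiply by minv u^2: every term carries a factor m v. *)
have {}E : u * D - w * L =
    2%:R * (u * D + u * lambda * w + (m - 1) * N).
  transitivity ((m * minv) * ((u * v) * u * D - (u * v) * (u * v) * w * L)).
    by rewrite uv mm; ring.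
  transitivity ((m * minv) * 2%:R * ((u * v) * u * D + (u * v) * u * lambda * w
            + (u * v) * (u * v) * (m - 1) * N)); last by rewrite uv mm; ring.
  by apply: etrans (etrans _ E) _; ring.
move/eqP: E; rewrite eq_sym -subr_eq0 => /eqP E.
apply: (lin3 E (erefl 0) (erefl 0)); ring.
Qed.

End Hessian.
End DifferentialRing.

(** * Partial derivatives of smooth functions *)

Section SmoothOn.
Variables (R : realType) (n : nat) (U : set 'rV[R]_n).
Hypothesis oU : open U.
Implicit Types (f g : 'rV[R]_n -> R) (x : 'rV[R]_n) (i j : 'I_n).

Lemma near_open x (P : set 'rV[R]_n) :
  U x -> (forall y, U y -> P y) -> \forall y \near x, P y.
Proof. by move=> Ux UP; apply: filterS UP _; exact: open_nbhs_nbhs. Qed.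

Lemma eq_partial i f g x : (forall y, U y -> f y = g y) -> U x ->
  partial i f x = partial i g x.
Proof. by move=> fg Ux; apply: near_eq_derive; exact: (near_open Ux fg). Qed.

Lemma eq_derivable v f g x : (forall y, U y -> f y = g y) -> U x ->
  derivable f x v -> derivable g x v.
Proof. by move=> fg Ux; apply: near_eq_derivable; exact: (near_open Ux fg). Qed.

Lemma eq_continuous f g x : (forall y, U y -> f y = g y) -> U x ->
  {for x, continuous f} -> {for x, continuous g}.
Proof.
move=> fg Ux; rewrite /prop_for /continuous_at -(fg x Ux) => cf.
exact: (cvg_trans (near_eq_cvg (F := nbhs x) (near_open Ux fg)) cf).
Qed.

Lemma smooth_partial i f : smooth_on U f -> smooth_on U (partial i f).
Proof.
move=> sf s x Ux; have := sf (rcons s i) x Ux.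
by rewrite /iter_partial -cats1 foldr_cat.
Qed.

Lemma smooth_continuous f x : smooth_on U f -> U x -> {for x, continuous f}.
Proof. by move=> sf /(sf [::])[]. Qed.

Lemma smooth_derivable f x i : smooth_on U f -> U x ->
  derivable f x (basis_vec R i).
Proof. by move=> sf /(sf [::])[]. Qed.

(** Smoothness by coinduction: a class of continuous functions with partial
    derivatives is a class of smooth functions as soon as it is closed, on U,
    under partial differentiation. *)
Lemma smooth_on_coind (P : ('rV[R]_n -> R) -> Prop) :
    (forall f, P f -> forall x, U x -> {for x, continuous f}) ->
    (forall f, P f -> forall i x, U x -> derivable f x (basis_vec R i)) ->
    (forall f, P f -> forall i, exists2 g, P g &
       forall x, U x -> partial i f x = g x) ->
  forall f, P f -> smooth_on U f.
Proof.
move=> Pc Pd Pp f Pf s.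
have [g Pg gE] : exists2 g, P g & forall x, U x -> g x = iter_partial s f x.
  elim: s => [|i s [g Pg gE]]; first by exists f.
  have [h Ph hE] := Pp _ Pg i; exists h => // x Ux.
  by rewrite -hE //=; apply: eq_partial.
move=> x Ux; split; first exact: eq_continuous (Pc _ Pg _ Ux).
by move=> i; apply: eq_derivable (Pd _ Pg _ _ Ux).
Qed.

(** All closure properties of smooth functions are obtained at once: the
    expressions built from smooth functions with ring operations and inverses
    are closed under partial differentiation. *)
Inductive smooth_expr : ('rV[R]_n -> R) -> Prop :=
| SE_smooth f : smooth_on U f -> smooth_expr f
| SE_cst c : smooth_expr (cst c)
| SE_add f g : smooth_expr f -> smooth_expr g -> smooth_expr (f \+ g)
| SE_opp f : smooth_expr f -> smooth_expr (\- f)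
| SE_mul f g : smooth_expr f -> smooth_expr g -> smooth_expr (f \* g)
| SE_inv f : (forall x, U x -> f x != 0) -> smooth_expr f ->
    smooth_expr (fun x => (f x)^-1).

Lemma smooth_expr_continuous f x : smooth_expr f -> U x -> {for x, continuous f}.
Proof.
move=> ef Ux; elim: ef => {f} [f|c|f g _ cf _ cg|f _ cf|f g _ cf _ cg|f f0 _ cf].
- by move/smooth_continuous; apply.
- exact: cst_continuous.
- exact: (cvgD cf cg).
- exact: (cvgN cf).
- exact: (cvgM cf cg).
- exact: (cvgV (f0 x Ux) cf).
Qed.

Lemma smooth_expr_derivable f x i : smooth_expr f -> U x ->
  derivable f x (basis_vec R i).
Proof.
move=> ef Ux; elim: ef => {f} [f|c|f g _ df _ dg|f _ df|f g _ df _ dg|f f0 _ df].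
- by move/smooth_derivable; apply.
- exact: derivable_cst.
- exact: derivableD.
- exact: derivableN.
- exact: derivableM.
- by apply: derivableV => //; exact: f0.
Qed.

Lemma smooth_expr_partial f i : smooth_expr f ->
  exists2 g, smooth_expr g & forall x, U x -> partial i f x = g x.
Proof.
elim=> {f} [f sf|c|f g ef [f' ef' pf] eg [g' eg' pg]|f ef [f' ef' pf]
           |f g ef [f' ef' pf] eg [g' eg' pg]|f f0 ef [f' ef' pf]].
- by exists (partial i f) => //; apply/SE_smooth/smooth_partial.
- by exists (cst 0); [exact: SE_cst|move=> x _; exact: derive_cst].
- exists (f' \+ g'); first exact: SE_add.
  by move=> x Ux; rewrite /= -pf // -pg //; apply: deriveD; exact: smooth_expr_derivable.
- exists (\- f'); first exact: SE_opp.
  by move=> x Ux; rewrite /= -pf //; apply: deriveN; exact: smooth_expr_derivable.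
- exists ((f \* g') \+ (g \* f')); first by apply: SE_add; exact: SE_mul.
  move=> x Ux; rewrite /= -pf // -pg //.
  by apply: deriveM; exact: smooth_expr_derivable.
- exists (\- ((fun x => (f x)^-1) \* (fun x => (f x)^-1) \* f')).
    by apply: SE_opp; apply: SE_mul => //; apply: SE_mul; exact: SE_inv.
  move=> x Ux; rewrite /= -pf // /partial deriveV ?f0 //; last exact: smooth_expr_derivable.
  by rewrite scaleNr expr2 invfM.
Qed.

Lemma smooth_expr_smooth f : smooth_expr f -> smooth_on U f.
Proof.
apply: smooth_on_coind => {f} [f ef x Ux|f ef i x Ux|f ef i].
- exact: smooth_expr_continuous.
- exact: smooth_expr_derivable.
- exact: smooth_expr_partial.
Qed.

Lemma smooth_cst c : smooth_on U (cst c).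
Proof. exact/smooth_expr_smooth/SE_cst. Qed.

Lemma smoothD f g : smooth_on U f -> smooth_on U g -> smooth_on U (f \+ g).
Proof. by move=> sf sg; apply/smooth_expr_smooth/SE_add; exact: SE_smooth. Qed.

Lemma smoothN f : smooth_on U f -> smooth_on U (\- f).
Proof. by move=> sf; apply/smooth_expr_smooth/SE_opp/SE_smooth. Qed.

Lemma smoothM f g : smooth_on U f -> smooth_on U g -> smooth_on U (f \* g).
Proof. by move=> sf sg; apply/smooth_expr_smooth/SE_mul; exact: SE_smooth. Qed.

Lemma smoothV f : (forall x, U x -> f x != 0) -> smooth_on U f ->
  smooth_on U (fun x => (f x)^-1).
Proof. by move=> f0 sf; apply/smooth_expr_smooth/SE_inv => //; exact: SE_smooth. Qed.

Lemma eq_smooth f g : (forall x, U x -> f x = g x) -> smooth_on U f ->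
  smooth_on U g.
Proof.
move=> fg sf.
have E s x : U x -> iter_partial s f x = iter_partial s g x.
  by elim: s x => [|i s IH] x Ux; [exact: fg|exact: eq_partial].
move=> s x Ux; have [cf df] := sf s x Ux; split; first exact: (eq_continuous (E s) Ux cf).
by move=> i; exact: (eq_derivable (E s) Ux (df i)).
Qed.

Lemma smooth_sum I (r : seq I) (P : pred I) (F : I -> 'rV[R]_n -> R) :
  (forall k, P k -> smooth_on U (F k)) ->
  smooth_on U (fun x => \sum_(k <- r | P k) F k x).
Proof.
move=> sF; elim: r => [|k r IH].
  by apply: eq_smooth (smooth_cst 0) => x _; rewrite big_nil.
have [Pk|/negPf Pk] := boolP (P k).
  by apply: eq_smooth (smoothD (sF k Pk) IH) => x _; rewrite big_cons Pk.
by apply: eq_smooth IH => x _; rewrite big_cons Pk.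
Qed.

Lemma smooth_prod I (r : seq I) (P : pred I) (F : I -> 'rV[R]_n -> R) :
  (forall k, P k -> smooth_on U (F k)) ->
  smooth_on U (fun x => \prod_(k <- r | P k) F k x).
Proof.
move=> sF; elim: r => [|k r IH].
  by apply: eq_smooth (smooth_cst 1) => x _; rewrite big_nil.
have [Pk|/negPf Pk] := boolP (P k).
  by apply: eq_smooth (smoothM (sF k Pk) IH) => x _; rewrite big_cons Pk.
by apply: eq_smooth IH => x _; rewrite big_cons Pk.
Qed.

Lemma partialD i f g x : smooth_on U f -> smooth_on U g -> U x ->
  partial i (fun y => f y + g y) x = partial i f x + partial i g x.
Proof. by move=> sf sg Ux; apply: deriveD; exact: smooth_derivable. Qed.

Lemma partialN i f x : smooth_on U f -> U x ->
  partial i (fun y => - f y) x = - partial i f x.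
Proof. by move=> sf Ux; apply: deriveN; exact: smooth_derivable. Qed.

Lemma partialM i f g x : smooth_on U f -> smooth_on U g -> U x ->
  partial i (fun y => f y * g y) x = partial i f x * g x + f x * partial i g x.
Proof.
move=> sf sg Ux; rewrite [LHS](deriveM (smooth_derivable sf Ux) (smooth_derivable sg Ux)).
by rewrite addrC mulrC.
Qed.

Lemma partial_cst i c x : partial i (fun=> c) x = 0 :> R.
Proof. exact: derive_cst. Qed.

Lemma partial_sum i I (r : seq I) (P : pred I) (F : I -> 'rV[R]_n -> R) x :
  (forall k, P k -> smooth_on U (F k)) -> U x ->
  partial i (fun y => \sum_(k <- r | P k) F k y) x = \sum_(k <- r | P k) partial i (F k) x.
Proof.
move=> sF Ux; elim: r => [|k r IH].
  rewrite big_nil (_ : (fun _ => _) = cst 0) ?partial_cst //.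
  by apply/funext => y; rewrite big_nil.
rewrite big_cons -IH; have [Pk|/negPf Pk] := boolP (P k).
  rewrite -partialD //; [|exact: sF|exact: smooth_sum].
  by congr (partial i _ x); apply/funext => y; rewrite big_cons Pk.
by congr (partial i _ x); apply/funext => y; rewrite big_cons Pk.
Qed.

End SmoothOn.

Section LineDerivatives.
Variables (R : realType) (n : nat).
Implicit Types (f : 'rV[R]_n -> R) (x y v w : 'rV[R]_n).

Lemma line_is_derive f y w (s : R) : derivable f (y + s *: w) w ->
  is_derive s 1 (fun t : R => f (y + t *: w)) ('D_w f (y + s *: w)).
Proof.
have E : (fun h : R => h^-1 *: (f (y + (h *: 1 + s) *: w) - f (y + s *: w))) =
         (fun h : R => h^-1 *: (f (h *: w + (y + s *: w)) - f (y + s *: w))).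
  apply/funext => h; congr (_ *: (f _ - _)).
  by rewrite scalerDl [h *: 1]mulr1 addrCA.
by move=> fd; apply: DeriveDef; rewrite /derivable /derive /= E.
Qed.

(** The special case of [line_is_derive] that remains usable once [partial] is
    no longer unfolded. *)
Lemma line_is_partial f y i (s : R) : derivable f (y + s *: basis_vec R i) (basis_vec R i) ->
  is_derive s 1 (fun t : R => f (y + t *: basis_vec R i))
    (partial i f (y + s *: basis_vec R i)).
Proof. exact: line_is_derive. Qed.

End LineDerivatives.

Lemma derive_line (R : realType) (V W : normedModType R) (f : V -> W) x v :
  'D_v f x = 'D_1 (fun h : R => f (h *: v + x)) 0.
Proof.
have E : (fun h : R => h^-1 *: ((f \o shift x) (h *: v) - f x)) =
    (fun h : R => h^-1 *: (((fun k : R => f (k *: v + x)) \o shift 0) (h *: 1)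
                           - f (0 *: v + x))).
  by apply/funext => h; rewrite /= addr0 scale0r add0r [h *: 1]mulr1.
by rewrite /derive E.
Qed.

Lemma partial_line (R : realType) (n : nat) (f : 'rV[R]_n -> R) i x :
  partial i f x = 'D_1 (fun h : R => f (h *: basis_vec R i + x)) 0.
Proof. exact: derive_line. Qed.

Definition partial_mx (R : realType) (n p q : nat) (i : 'I_n)
  (A : 'rV[R]_n -> 'M[R]_(p, q)) (x : 'rV[R]_n) : 'M[R]_(p, q) :=
  \matrix_(k, l) partial i (fun y => A y k l) x.

Definition derivable_entries (R : realType) (n p q : nat) (i : 'I_n)
  (A : 'rV[R]_n -> 'M[R]_(p, q)) (x : 'rV[R]_n) :=
  forall k l, derivable (fun y => A y k l) x (basis_vec R i).

Lemma derivable_mulmx (R : realType) (n p q r : nat) (i : 'I_n)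
    (A : 'rV[R]_n -> 'M[R]_(p, q)) (B : 'rV[R]_n -> 'M[R]_(q, r)) x :
    derivable_entries i A x -> derivable_entries i B x ->
  derivable_entries i (fun y => A y *m B y) x.
Proof.
move=> dA dB k l.
have -> : (fun y => (A y *m B y) k l) =
    \sum_j ((fun y => A y k j) * (fun y => B y j l)).
  by apply/funext => y; rewrite mxE fct_sumE.
by apply: derivable_sum => j; exact: derivableM.
Qed.

Lemma partial_mulmx (R : realType) (n p q r : nat) (i : 'I_n)
    (A : 'rV[R]_n -> 'M[R]_(p, q)) (B : 'rV[R]_n -> 'M[R]_(q, r)) x :
    derivable_entries i A x -> derivable_entries i B x ->
  partial_mx i (fun y => A y *m B y) x =
  partial_mx i A x *m B x + A x *m partial_mx i B x.
Proof.
move=> dA dB; apply/matrixP => k l; rewrite !mxE.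
have -> : (fun y => (A y *m B y) k l) =
    \sum_j ((fun y => A y k j) * (fun y => B y j l)).
  by apply/funext => y; rewrite mxE fct_sumE.
rewrite -big_split [LHS]derive_sum => [|j]; last exact: derivableM.
apply: eq_bigr => j _; rewrite !mxE [LHS]deriveM //.
by rewrite addrC; congr (_ + _); exact: mulrC.
Qed.

Section Coordinates.
Variables (R : realType) (n : nat).

Lemma partial_coordinate i k (x : 'rV[R]_n) :
  partial i (fun y : 'rV[R]_n => y 0 k) x = (k == i)%:R.
Proof.
have := derive_mx (@derivable_id _ _ x (basis_vec R i)).
rewrite derive_id => /matrixP/(_ 0 k); rewrite !mxE eqxx /= => E.
by rewrite [RHS]E.
Qed.

(** Coordinates and constants form a class closed under differentiation. *)
Lemma smooth_coordinate (U : set 'rV[R]_n) k : open U ->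
  smooth_on U (fun y => y 0 k).
Proof.
move=> oU; pose P (f : 'rV[R]_n -> R) := f = (fun y => y 0 k) \/ exists c, f = cst c.
apply: (@smooth_on_coind _ _ _ oU P); last by left.
- move=> f [->|[c ->]] x _; last exact: cst_continuous.
  exact: coord_continuous.
- move=> f [->|[c ->]] i x _; last exact: derivable_cst.
  by have /derivable_mxP := @derivable_id _ _ x (basis_vec R i); apply.
- move=> f [->|[c ->]] i.
    exists (cst (k == i)%:R); first by right; exists (k == i)%:R.
    by move=> x _; exact: partial_coordinate.
  exists (cst 0); first by right; exists 0.
  by move=> x _; exact: partial_cst.
Qed.

End Coordinates.

Section SmoothInverse.
Variables (R : realType) (n : nat) (U : set 'rV[R]_n).
Hypothesis oU : open U.

Lemma smooth_det p (A : 'rV[R]_n -> 'M[R]_p) :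
  (forall i j, smooth_on U (fun x => A x i j)) -> smooth_on U (fun x => \det (A x)).
Proof.
move=> sA; apply: (smooth_sum oU) => s _.
apply: (smoothM oU (smooth_cst oU _)).
by apply: (smooth_prod oU) => i _.
Qed.

Lemma smooth_invmx p (A : 'rV[R]_n -> 'M[R]_p) :
    (forall i j, smooth_on U (fun x => A x i j)) ->
    (forall x, U x -> A x \in unitmx) ->
  forall i j, smooth_on U (fun x => invmx (A x) i j).
Proof.
move=> sA uA i j.
pose f x := (\det (A x))^-1 * ((-1) ^+ (j + i) * \det (row' j (col' i (A x)))).
apply: (@eq_smooth _ _ _ oU f).
  by move=> x Ux; rewrite /invmx uA // !mxE.
apply: (smoothM oU).
  apply: (smoothV oU); last exact: smooth_det.
  by move=> x /uA; rewrite unitmxE unitfE.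
apply: (smoothM oU (smooth_cst oU _)); apply: smooth_det => a b.
by apply: (eq_smooth oU) (sA (lift j a) (lift i b)) => x _; rewrite !mxE.
Qed.

End SmoothInverse.

(* Deciding by unfolding whether two partial derivatives agree means comparing
   two limits, which is prohibitively slow; from here on the lemmas above are
   the only access to them. *)
Local Opaque partial.

(** * Mean value theorem, differentiability and symmetry of second derivatives *)

(** Scaling the intermediate point by h avoids a case distinction on the sign
    of h.  It lies strictly inside, which [hess_local_max] needs. *)
Lemma MVT_from0 (R : realType) (f df : R -> R) (h : R) :
    (forall s : R, `|s| <= `|h| -> is_derive s 1 f (df s)) ->
  exists2 t, 0 < t < 1 & f h - f 0 = df (t * h) * h.
Proof.
move=> fd.
have cf s : `|s| <= `|h| -> {for s, continuous f}.
  by move=> /fd[fs _]; apply: differentiable_continuous; exact/derivable1_diffP.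
have [h0|h0|h0] := ltgtP h 0.
- have [|x|c] := @MVT R f df h 0 h0.
  + move=> s; rewrite in_itv /= => /andP[s0 sh]; apply: fd.
    by rewrite !ltr0_norm // lerN2 ltW.
  + apply: continuous_in_subspaceT => s; rewrite inE /= in_itv /= => /andP[s0 sh].
    by apply: cf; rewrite (ltr0_norm h0) ler0_norm // lerN2.
  rewrite in_itv /= => /andP[c0 ch]; rewrite sub0r mulrN => E.
  exists (c / h).
    apply/andP; split; last by rewrite ltr_ndivrMr // mul1r.
    by rewrite -mulrNN -invrN divr_gt0 ?oppr_gt0.
  by rewrite divfK ?lt_eqF // -[LHS]opprB E opprK.
- have [|x|c] := @MVT R f df 0 h h0.
  + move=> s; rewrite in_itv /= => /andP[s0 sh]; apply: fd.
    by rewrite !gtr0_norm // ltW.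
  + apply: continuous_in_subspaceT => s; rewrite inE /= in_itv /= => /andP[s0 sh].
    by apply: cf; rewrite (gtr0_norm h0) ger0_norm.
  rewrite in_itv /= => /andP[c0 ch]; rewrite subr0 => E.
  exists (c / h); first by rewrite divr_gt0 //= ltr_pdivrMr // mul1r.
  by rewrite divfK ?gt_eqF.
- exists (2^-1); first by rewrite invr_gt0 invf_lt1 ?ltr1n ?ltr0n.
  by rewrite h0 subrr mulr0.
Qed.

Section Lines.
Variables (R : realType) (n : nat).
Implicit Types (f : 'rV[R]_n -> R) (x y v w : 'rV[R]_n).

Lemma norm_row v i : `|v 0 i| <= `|v|.
Proof.
by rewrite [`|v|]mx_normrE; exact: (le_bigmax _ (fun ij => `|v ij.1 ij.2|) (0, i)).
Qed.

Lemma norm_row_le v (e : R) : 0 <= e -> (forall i, `|v 0 i| <= e) -> `|v| <= e.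
Proof.
move=> e0 ve; rewrite [`|v|]mx_normrE; apply: bigmax_le => // -[i j] _ /=.
by rewrite (ord1 i).
Qed.

Variables (U : set 'rV[R]_n).
Hypothesis oU : open U.

Lemma open_norm x : U x -> exists2 r, 0 < r & forall y, `|y - x| < r -> U y.
Proof.
move=> Ux; have /nbhs_ballP[r /= r0 rU] := open_nbhs_nbhs (conj oU Ux).
by exists r => // y; rewrite distrC => yr; apply: rU; rewrite -ball_normE.
Qed.

(** One step of the coordinatewise path from x to x + v. *)
Lemma coord_increment f y i (h c e : R) : smooth_on U f ->
    (forall s, `|s| <= `|h| -> U (y + s *: basis_vec R i) /\
       `|partial i f (y + s *: basis_vec R i) - c| <= e) ->
  `|f (y + h *: basis_vec R i) - f y - h * c| <= e * `|h|.
Proof.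
move=> sf P.
have [s sh E] : exists2 s, `|s| <= `|h| & f (y + h *: basis_vec R i) - f y =
    partial i f (y + s *: basis_vec R i) * h.
  have [|t /andP[t0 t1]] := @MVT_from0 R (fun t => f (y + t *: basis_vec R i))
     (fun t => partial i f (y + t *: basis_vec R i)) h.
    by move=> s /P[Us _]; apply: line_is_partial; exact: (smooth_derivable sf Us).
  rewrite scale0r addr0 => E; exists (t * h) => //.
  by rewrite normrM gtr0_norm // ler_piMl // ltW.
rewrite E mulrC -mulrBr normrM mulrC ler_wpM2r //.
by have [] := P s sh.
Qed.

Definition take_row v k : 'rV[R]_n := \row_j (if (j < k)%N then v 0 j else 0).

Lemma norm_take_row v k (i : 'I_n) (s : R) : (k <= i)%N -> `|s| <= `|v| ->
  `|take_row v k + s *: basis_vec R i| <= `|v|.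
Proof.
move=> ki sv; apply: norm_row_le => // j; rewrite !mxE eqxx /=.
have [->|ji] := eqVneq j i; first by rewrite ltnNge ki add0r mulr1.
by rewrite mulr0 addr0; case: ifP => _; rewrite ?normr0 ?norm_row.
Qed.

Lemma take_rowS v (i : 'I_n) :
  take_row v i.+1 = take_row v i + v 0 i *: basis_vec R i.
Proof.
apply/rowP => j; rewrite !mxE eqxx /= ltnS.
have [->|ji] := eqVneq j i; first by rewrite leqnn ltnn add0r mulr1.
by rewrite mulr0 addr0 leq_eqVlt (inj_eq val_inj) (negPf ji).
Qed.

(** Continuous partial derivatives give a first order expansion: go from x to
    x + v one coordinate at a time, and apply the mean value theorem to each of
    the n steps; [e'] leaves room for all of them. *)
Lemma first_order f x : smooth_on U f -> U x -> forall e : R, 0 < e ->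
  exists2 r, 0 < r & forall v, `|v| <= r ->
    `|f (x + v) - f x - \sum_i v 0 i * partial i f x| <= e * `|v|.
Proof.
move=> sf Ux e e0.
pose e' := e / n.+1%:R.
have e'0 : 0 < e' by rewrite divr_gt0.
have [r r0 rP] : exists2 r, 0 < r & forall y, `|y - x| < r -> forall i,
    U y /\ `|partial i f y - partial i f x| <= e'.
  have [r r0 rU] := open_norm Ux.
  have : \forall y \near x, forall i, `|partial i f y - partial i f x| <= e'.
    apply: (@filter_forall _ _ (fun i y => `|partial i f y - partial i f x| <= e') (nbhs x)) => i.
    have /cvgrPdist_le/(_ _ e'0) := smooth_continuous (smooth_partial i sf) Ux.
    by apply: filterS => y; rewrite distrC.
  case/nbhs_ballP => r' /= r'0 r'P; exists (Num.min r r'); first by rewrite lt_min r0.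
  move=> y; rewrite lt_min => /andP[/rU Uy yr'] i; split=> //.
  by apply: r'P; rewrite -ball_normE /ball_ /= distrC.
exists (r / 2); first by rewrite divr_gt0.
move=> v vr.
have tE : f (x + v) - f x =
    \sum_(i < n) (f (x + take_row v i.+1) - f (x + take_row v i)).
  rewrite -(big_mkord xpredT (fun i => f (x + take_row v i.+1) - f (x + take_row v i))).
  rewrite telescope_sumr //; congr (f (x + _) - f _).
    by apply/rowP => j; rewrite mxE ltn_ord.
  rewrite (_ : take_row v 0 = 0) ?addr0 //.
  by apply/rowP => j; rewrite !mxE.
rewrite tE -sumrB; apply: le_trans (ler_norm_sum _ _ _) _.
apply: (@le_trans _ _ (\sum_(i < n) e' * `|v|)).
  apply: ler_sum => i _; rewrite take_rowS addrA.
  apply: (@le_trans _ _ (e' * `|v 0 i|)); last by rewrite ler_wpM2l ?norm_row // ltW.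
  apply: coord_increment => // s sv; apply: rP.
  rewrite -[x + _ + _]addrA [x + _]addrC addrK.
  apply: (@le_lt_trans _ _ `|v|); last by lra.
  apply: norm_take_row => //; exact: (le_trans sv (norm_row _ _)).
rewrite sumr_const card_ord -mulr_natr mulrAC ler_wpM2r //.
rewrite /e' -mulrA ler_piMr ?(ltW e0) // mulrC ler_pdivrMr ?ltr0n //.
by rewrite mul1r ler_nat.
Qed.

Definition linear_part f x : 'rV[R]_n -> R :=
  fun v => \sum_i v 0 i * partial i f x.

Lemma linear_part_is_linear f x : linear (linear_part f x).
Proof.
move=> a v w; rewrite /linear_part scaler_sumr -big_split; apply: eq_bigr => i _.
by rewrite !mxE mulrDl -mulrA.
Qed.

HB.instance Definition _ f x :=
  GRing.isLinear.Build R 'rV[R]_n R _ (linear_part f x) (linear_part_is_linear f x).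

Lemma linear_part_continuous f x : continuous (linear_part f x).
Proof.
apply: bounded_linear_continuous; apply/linear_boundedP.
near=> M => v; rewrite /= /linear_part.
apply: le_trans (ler_norm_sum _ _ _) _.
apply: (@le_trans _ _ ((\sum_i `|partial i f x|) * `|v|)).
  rewrite mulr_suml; apply: ler_sum => i _.
  by rewrite normrM mulrC ler_wpM2l ?norm_row.
by rewrite ler_wpM2r //; near: M; apply: nbhs_pinfty_ge; rewrite num_real.
Unshelve. all: by end_near. Qed.

Lemma smooth_expansion f x : smooth_on U f -> U x ->
  (f \o shift x : 'rV[R]_n -> R^o) = cst (f x) + linear_part f x +o_ (0 : 'rV[R]_n) id.
Proof.
move=> sf Ux; apply/eqaddoP => e e0.
have [r r0 rP] := first_order sf Ux e0.
apply/nbhs_ballP; exists r => //= v; rewrite -ball_normE /= sub0r normrN => vr.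
have := rP v (ltW vr); rewrite opprD addrA -[x + v]addrC.
exact.
Qed.

Lemma smooth_differentiable f x : smooth_on U f -> U x -> differentiable f x.
Proof.
move=> sf Ux.
have E := diff_unique (@linear_part_continuous f x) (smooth_expansion sf Ux).
apply/diff_locallyP; rewrite E; split; first exact: linear_part_continuous.
exact: smooth_expansion.
Qed.

Lemma smooth_derive f x v : smooth_on U f -> U x ->
  'D_v f x = \sum_i v 0 i * partial i f x.
Proof.
move=> sf Ux; rewrite deriveE; last exact: smooth_differentiable.
by rewrite (diff_unique (@linear_part_continuous f x) (smooth_expansion sf Ux)).
Qed.

End Lines.

Lemma norm_basis_vec (R : realType) (n : nat) (i : 'I_n) : `|basis_vec R i| <= 1.
Proof.
apply: norm_row_le => // j; rewrite !mxE eqxx /=.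
by case: eqP; rewrite ?normr1 ?normr0.
Qed.

(** The intersection of filters with the filter fixed, so that it can be used
    forwards. *)
Lemma nbhsI_rV (R : realType) (n : nat) (x : 'rV[R]_n) (P Q : set 'rV[R]_n) :
  nbhs x P -> nbhs x Q -> nbhs x (P `&` Q).
Proof. exact: filterI. Qed.

Lemma distr_halves (R : realType) (a b c e : R) :
  `|b - c| <= e / 2 -> `|a - c| <= e / 2 -> `|a - b| <= e.
Proof.
move=> bc ac; rewrite (splitr e) -(subrKA c).
by apply: le_trans (ler_normD _ _) _; apply: lerD; rewrite // distrC.
Qed.

Section Calculus.
Variables (R : realType) (n : nat) (U : set 'rV[R]_n).
Hypothesis oU : open U.
Implicit Types (f : 'rV[R]_n -> R) (x y v w : 'rV[R]_n).

Lemma segment_MVT f y v (h : R) : smooth_on U f ->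
    (forall s : R, `|s| <= `|h| -> U (y + s *: v)) ->
  exists2 t, 0 < t < 1 & f (y + h *: v) - f y =
    (\sum_i v 0 i * partial i f (y + (t * h) *: v)) * h.
Proof.
move=> sf Us.
have [|t t01] := @MVT_from0 R (fun t => f (y + t *: v))
  (fun t => \sum_i v 0 i * partial i f (y + t *: v)) h.
  move=> s /Us Uys; rewrite -(smooth_derive oU v sf Uys).
  by apply: line_is_derive; apply: diff_derivable; exact: (smooth_differentiable oU sf Uys).
by rewrite scale0r addr0 => E; exists t.
Qed.

(** Mean value theorem on the segment from x to a point of a ball around x. *)
Lemma locally_constant f x : smooth_on U f ->
    (forall i y, U y -> partial i f y = 0) -> U x ->
  \forall y \near x, f y = f x.
Proof.
move=> sf pf0 Ux; have [r r0 rU] := open_norm oU Ux.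
apply/nbhs_ballP; exists r => //= y; rewrite -ball_normE /= distrC => yr.
have UP (s : R) : `|s| <= `|1 : R| -> U (x + s *: (y - x)).
  rewrite normr1 => s1; apply: rU; rewrite [x + _]addrC addrK normrZ.
  by apply: le_lt_trans yr; rewrite ler_piMl.
have [t /andP[t0 t1]] := segment_MVT sf UP.
rewrite scale1r [x + _]addrC subrK mulr1 big1 => [/eqP|i _].
  by rewrite subr_eq0 => /eqP.
rewrite pf0 ?mulr0 //; apply: UP.
by rewrite normrM gtr0_norm // ler_piMl // ltW.
Qed.

(** The second difference of f over a square of side t is t^2 times a mixed
    second derivative at some point of the square: the mean value theorem is
    applied in direction i, then in direction j. *)
Lemma mixed_difference f x i j (t : R) : smooth_on U f ->
    (forall s s' : R, `|s| <= `|t| -> `|s'| <= `|t| ->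
       U (x + s *: basis_vec R i + s' *: basis_vec R j)) ->
  exists s s' : R, [/\ `|s| <= `|t|, `|s'| <= `|t| &
    f (x + t *: basis_vec R i + t *: basis_vec R j)
    - f (x + t *: basis_vec R i) - f (x + t *: basis_vec R j) + f x =
    partial j (partial i f) (x + s *: basis_vec R i + s' *: basis_vec R j)
      * t * t].
Proof.
move=> sf Us.
have Us0 (s : R) : `|s| <= `|t| -> U (x + s *: basis_vec R i).
  by move=> st; have := Us s 0 st; rewrite normr0 scale0r addr0; apply.
pose g (s : R) := f ((x + t *: basis_vec R j) + s *: basis_vec R i)
                 - f (x + s *: basis_vec R i).
have [|s /andP[s0 s1]] := @MVT_from0 R g (fun s =>
   partial i f ((x + t *: basis_vec R j) + s *: basis_vec R i)
     - partial i f (x + s *: basis_vec R i)) t.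
  move=> s st; apply: is_deriveB.
    apply: line_is_partial; apply: (smooth_derivable sf).
    by rewrite addrAC; exact: Us.
  by apply: line_is_partial; apply: (smooth_derivable sf); exact: Us0.
have st : `|s * t| <= `|t| by rewrite normrM gtr0_norm // ler_piMl // ltW.
rewrite /g scale0r !addr0 [x + t *: basis_vec R j + _]addrAC.
rewrite -[X in X = _ -> _]addrA => E0.
have [|s' /andP[s'0 s'1] E] := @MVT_from0 R
  (fun s' => partial i f (x + (s * t) *: basis_vec R i + s' *: basis_vec R j))
  (fun s' => partial j (partial i f)
     (x + (s * t) *: basis_vec R i + s' *: basis_vec R j)) t.
  move=> s' s't; apply: line_is_partial.
  by apply: (smooth_derivable (smooth_partial i sf)); exact: Us.
exists (s * t), (s' * t); split => //.
  by rewrite normrM gtr0_norm // ler_piMl // ltW.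
rewrite -E scale0r addr0 [x + (s * t) *: _ + _]addrAC -E0; ring.
Qed.

(** The second difference is symmetric in i and j, so [mixed_difference] gives
    points arbitrarily near x where the two mixed derivatives agree. *)
Lemma partialC f x i j : smooth_on U f -> U x ->
  partial i (partial j f) x = partial j (partial i f) x.
Proof.
move=> sf Ux; apply/eqP; rewrite -subr_eq0 -normr_le0; apply/ler_addgt0Pl => e e0.
rewrite addr0.
have e20 : 0 < e / 2 by rewrite divr_gt0.
have cont k l : \forall y \near x,
    `|partial k (partial l f) x - partial k (partial l f) y| <= e / 2.
  have /cvgrPdist_le/(_ _ e20) := smooth_continuous
     (smooth_partial k (smooth_partial l sf)) Ux.
  exact.
have [r r0 rP] : exists2 r, 0 < r & forall y, `|y - x| < r -> [/\ U y,
   `|partial i (partial j f) x - partial i (partial j f) y| <= e / 2 &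
   `|partial j (partial i f) x - partial j (partial i f) y| <= e / 2].
  have [r /= r0 rP] : nbhs_ball x [set y | [/\ U y,
      `|partial i (partial j f) x - partial i (partial j f) y| <= e / 2 &
      `|partial j (partial i f) x - partial j (partial i f) y| <= e / 2]].
    apply/nbhs_ballP.
    have := nbhsI_rV (open_nbhs_nbhs (conj oU Ux)) (nbhsI_rV (cont i j) (cont j i)).
    by apply: filterS => y [? []]; split.
  by exists r => // y; rewrite distrC => yr; apply: rP; rewrite -ball_normE.
pose t := r / 3.
have t0 : 0 < t by rewrite divr_gt0.
have near k l (s s' : R) : `|s| <= `|t| -> `|s'| <= `|t| ->
    `|(x + s *: basis_vec R k + s' *: basis_vec R l) - x| < r.
  rewrite (gtr0_norm t0) => st s't.
  rewrite -[x + _ + _]addrA [x + _]addrC addrK; apply: le_lt_trans (ler_normD _ _) _.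
  rewrite !normrZ; apply: (@le_lt_trans _ _ (t + t)); last by rewrite /t; lra.
  apply: lerD; rewrite -[leRHS]mulr1; apply: ler_pM => //; exact: norm_basis_vec.
have [|s [s' [st s't E1]]] := @mixed_difference f x i j t sf.
  by move=> s s' st s't; have [] := rP _ (near i j _ _ st s't).
have [|q [q' [qt q't E2]]] := @mixed_difference f x j i t sf.
  by move=> q q' qt q't; have [] := rP _ (near j i _ _ qt q't).
have [_ _ b1] := rP _ (near i j _ _ st s't).
have [_ b2 _] := rP _ (near j i _ _ qt q't).
have E : partial j (partial i f) (x + s *: basis_vec R i + s' *: basis_vec R j) =
         partial i (partial j f) (x + q *: basis_vec R j + q' *: basis_vec R i).
  have tn0 : t != 0 by rewrite gt_eqF.
  have cancel (a b : R) : a * t * t = b * t * t -> a = b.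
    by move=> /(mulIf tn0) /(mulIf tn0).
  apply: cancel; refine (etrans (esym E1) (etrans _ E2)).
  rewrite [x + t *: basis_vec R i + _]addrAC.
  congr (_ + _); exact: addrAC.
rewrite E in b1; exact: (distr_halves b1 b2).
Qed.

Lemma partial_local_max f x i : smooth_on U f -> U x ->
  (\forall y \near x, f y <= f x) -> partial i f x = 0.
Proof.
move=> sf Ux fmax.
have [r /= r0 rP] : nbhs_ball x [set y | U y /\ f y <= f x].
  by apply/nbhs_ballP; exact: nbhsI_rV (open_nbhs_nbhs (conj oU Ux)) fmax.
have sP (s : R) : `|s| < r -> U (x + s *: basis_vec R i) /\
    f (x + s *: basis_vec R i) <= f x.
  move=> sr; apply: rP; rewrite -ball_normE /= opprD addrA subrr sub0r normrN normrZ.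
  apply: le_lt_trans sr; rewrite -[leRHS]mulr1; apply: ler_wpM2l => //.
  exact: norm_basis_vec.
have dl (s : R) : `|s| < r -> is_derive s 1 (fun t : R => f (x + t *: basis_vec R i))
      (partial i f (x + s *: basis_vec R i)).
  by move=> /sP[Us _]; apply: line_is_partial; exact: (smooth_derivable sf Us).
have : is_derive (0 : R) 1 (fun t : R => f (x + t *: basis_vec R i)) 0.
  apply: (@derive1_at_max R _ (- r) r).
  - by rewrite ge0_cp // ltW.
  - by move=> t; rewrite in_itv /= -ltr_norml => /dl[].
  - by rewrite in_itv /= oppr_lt0 r0.
  - move=> t; rewrite in_itv /= -ltr_norml => /sP[_].
    by rewrite scale0r addr0.
have d0 : is_derive (0 : R) 1 (fun t : R => f (x + t *: basis_vec R i)) (partial i f x).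
  by have := dl 0; rewrite normr0 scale0r addr0; exact.
by move=> /@derive_val <-; rewrite (@derive_val _ _ _ _ _ _ _ d0).
Qed.

(** If the second derivative Q along v were positive at x, then on a short
    segment from x the directional derivative q, which vanishes at x, would be
    positive, and so would be the increment of f. *)
Lemma hess_local_max f x v : smooth_on U f -> U x ->
  (\forall y \near x, f y <= f x) ->
  \sum_i \sum_j v 0 i * v 0 j * partial i (partial j f) x <= 0.
Proof.
move=> sf Ux fmax; rewrite leNgt; apply/negP => Qpos.
pose q := fun y => \sum_j v 0 j * partial j f y.
have sF j : smooth_on U (fun y => v 0 j * partial j f y).
  by apply: (smoothM oU (smooth_cst oU (v 0 j))); exact: smooth_partial.
have sq : smooth_on U q by apply: (smooth_sum oU) => j _; exact: sF.
have qE i y : U y -> partial i q y = \sum_j v 0 j * partial i (partial j f) y.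
  move=> Uy; rewrite (@partial_sum _ _ _ oU i _ _ _ _ y (fun j _ => sF j) Uy).
  apply: eq_bigr => j _; rewrite (partialM _ (smooth_cst oU (v 0 j)) (smooth_partial j sf) Uy).
  by rewrite partial_cst mul0r add0r.
pose Q := fun y => \sum_i v 0 i * partial i q y.
have Qx : 0 < Q x.
  apply: lt_le_trans Qpos _; rewrite le_eqVlt; apply/orP; left; apply/eqP.
  apply: eq_bigr => i _; rewrite qE // mulr_sumr.
  by apply: eq_bigr => j _; rewrite mulrA.
have cQ : {for x, continuous Q}.
  apply: smooth_continuous Ux; apply: (smooth_sum oU) => j _.
  by apply: (smoothM oU (smooth_cst oU (v 0 j))); exact: smooth_partial.
have [r /= r0 rP] : nbhs_ball x [set y | [/\ U y, f y <= f x & 0 < Q y]].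
  apply/nbhs_ballP.
  have Qn : \forall y \near x, 0 < Q y by exact: (cvgr_gt _ cQ).
  have := nbhsI_rV Qn (nbhsI_rV (open_nbhs_nbhs (conj oU Ux)) fmax).
  by apply: filterS => y [? []]; split.
pose t := r / (2 * (1 + `|v|)).
have v1 : 0 < 1 + `|v| by rewrite ltr_pwDl.
have t0 : 0 < t by rewrite divr_gt0 // mulr_gt0.
have sP (s : R) : `|s| <= `|t| -> [/\ U (x + s *: v),
    f (x + s *: v) <= f x & 0 < Q (x + s *: v)].
  rewrite (gtr0_norm t0) => st; apply: rP.
  rewrite -ball_normE /= opprD addrA subrr sub0r normrN normrZ.
  apply: (@le_lt_trans _ _ (t * (1 + `|v|))).
    by apply: ler_pM => //; rewrite lerDr.
  rewrite /t invfM mulrA mulfVK ?gt_eqF //; lra.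
have [|a /andP[a0 a1]] := @segment_MVT f x v t sf; first by move=> s /sP[].
rewrite -/(q _) => E1.
have att : `|a * t| <= `|t| by rewrite normrM gtr0_norm // ler_piMl // ltW.
have [|b /andP[b0 b1]] := @segment_MVT q x v (a * t) sq.
  by move=> s sat; have [] := sP _ (le_trans sat att).
have -> : q x = 0.
  by rewrite /q big1 // => i _; rewrite (partial_local_max _ sf Ux fmax) mulr0.
rewrite -/(Q _) subr0 => E2.
have [_ _ Qb] : [/\ U (x + (b * (a * t)) *: v),
    f (x + (b * (a * t)) *: v) <= f x & 0 < Q (x + (b * (a * t)) *: v)].
  by apply: sP; apply: le_trans att; rewrite normrM gtr0_norm // ler_piMl // ltW.
have [_ + _] := sP t (lexx _); rewrite -subr_le0 E1 E2 leNgt => /negP; apply.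
by rewrite !mulr_gt0.
Qed.

End Calculus.

Section ChainRule.
Variables (R : realType) (n m : nat) (U : set 'rV[R]_n) (V : set 'rV[R]_m).
Hypotheses (oU : open U) (oV : open V).

(** Chain rule, through the curve h |-> tau (x + h e_i). *)
Lemma partial_comp (tau : 'rV[R]_n -> 'rV[R]_m) (f : 'rV[R]_m -> R) x i :
    (forall k, smooth_on U (fun y => tau y 0 k)) -> smooth_on V f ->
    U x -> V (tau x) ->
  partial i (fun y => f (tau y)) x =
  \sum_k partial i (fun y => tau y 0 k) x * partial k f (tau x).
Proof.
move=> st sf Ux Vx.
have dt : derivable tau x (basis_vec R i).
  by apply/derivable_mxP => a b; rewrite (ord1 a); exact: (smooth_derivable (st b) Ux).
pose L (h : R) := tau (h *: basis_vec R i + x).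
have L0 : L 0 = tau x by rewrite /L scale0r add0r.
have dL : differentiable L 0 by apply/derivable1_diffP/(derivable1P _ _ _).1.
have df : differentiable f (L 0) by rewrite L0; exact: (smooth_differentiable oV sf Vx).
have -> : partial i (fun y => f (tau y)) x = 'D_('D_(basis_vec R i) tau x) f (tau x).
  have dE : 'D_(basis_vec R i) tau x = 'D_1 L 0 by rewrite derive_line.
  have cE : partial i (fun y => f (tau y)) x = 'D_1 (f \o L) 0.
    exact: partial_line.
  rewrite cE dE (deriveE _ (differentiable_comp dL df)) diff_comp //=.
  by rewrite -L0 -(deriveE _ dL) -(deriveE _ df).
rewrite (smooth_derive oV _ sf Vx); apply: eq_bigr => k _.
by rewrite derive_mx // mxE.
Qed.

Lemma derivable_comp (tau : 'rV[R]_n -> 'rV[R]_m) (f : 'rV[R]_m -> R) x i :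
    (forall k, smooth_on U (fun y => tau y 0 k)) -> smooth_on V f ->
    U x -> V (tau x) ->
  derivable (fun y => f (tau y)) x (basis_vec R i).
Proof.
move=> st sf Ux Vx; apply/derivable1P/derivable1_diffP.
pose L (h : R) := tau (h *: basis_vec R i + x).
have dL : differentiable L 0.
  apply/derivable1_diffP/(derivable1P _ _ _).1/derivable_mxP => a b.
  by rewrite (ord1 a); exact: (smooth_derivable (st b) Ux).
apply: (differentiable_comp dL); rewrite /L scale0r add0r.
exact: (smooth_differentiable oV sf Vx).
Qed.

End ChainRule.

(** * The ring of smooth functions on a coordinate domain *)

(** The squared norm of the gradient is the dual norm of the differential. *)
Lemma sqnorm_gradient (R : realType) (n : nat) (g : 'rV[R]_n -> 'M[R]_n)
    (f : 'rV[R]_n -> R) x : g x \in unitmx ->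
  sqnorm g (gradient g f) x =
  \sum_i \sum_j invmx (g x) i j * partial i f x * partial j f x.
Proof.
move=> gu.
have E i : \sum_j g x i j * gradient g f x 0 j = partial i f x.
  under eq_bigr => j _ do rewrite mxE mulr_sumr.
  rewrite exchange_big /= (bigD1 i) //= [X in _ + X]big1 => [|l li].
    under eq_bigr => j _ do rewrite mulrA.
    have /matrixP/(_ i i) := mulmxV gu; rewrite !mxE eqxx => e.
    by rewrite -mulr_suml e mul1r addr0.
  under eq_bigr => j _ do rewrite mulrA.
  have /matrixP/(_ i l) := mulmxV gu.
  by rewrite !mxE eq_sym (negPf li) -mulr_suml => ->; rewrite mul0r.
rewrite /sqnorm; transitivity (\sum_i gradient g f x 0 i * partial i f x).
  apply: eq_bigr => i _; rewrite -E mulr_sumr; apply: eq_bigr => j _.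
  by rewrite mulrA [gradient _ _ _ _ _ * _]mulrC.
apply: eq_bigr => l _; rewrite mxE mulr_suml; apply: eq_bigr => p _.
exact: mulrAC.
Qed.

Record region (R : realType) (n : nat) := Region {
  region_set : set 'rV[R]_n;
  region_open : open region_set;
  region_neq0 : region_set !=set0
}.

(** Smooth functions on D, extended by zero so that functions with the same
    restriction to D are equal.  D is bundled as a nonempty open set for the
    unit to be nonzero. *)
Record smooth_fn (R : realType) (n : nat) (D : region R n) := SmoothFn {
  fval :> 'rV[R]_n -> R;
  fval_smooth : smooth_on (region_set D) fval;
  fval_out : forall x, ~ region_set D x -> fval x = 0
}.

Section SmoothRing.
Variables (R : realType) (n : nat) (D : region R n).
Local Notation F := (smooth_fn D).
Local Notation U := (region_set D).
Let oU := @region_open _ _ D.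

Lemma smooth_fn_ext (a b : F) : (forall x, U x -> a x = b x) -> a = b.
Proof.
move=> ab; have : fval a = fval b.
  apply/funext => x; have [Ux|nUx] := pselect (U x); first exact: ab.
  by rewrite !fval_out.
case: a b {ab} => [f sf of_] [g sg og] /= fg; rewrite fg in sf of_ *.
by congr SmoothFn; exact: Prop_irrelevance.
Qed.

Lemma sfn_key f : smooth_on U f ->
  {a : F | forall x, U x -> a x = f x}.
Proof.
move=> sf; pose h (x : 'rV[R]_n) : R := f x * (x \in U)%:R.
have hE x : U x -> f x = h x by move=> Ux; rewrite /h mem_set // mulr1.
have h0 x : ~ U x -> h x = 0 by move=> nUx; rewrite /h memNset // mulr0.
by exists (SmoothFn (eq_smooth oU hE sf) h0) => x Ux; rewrite hE.
Qed.

End SmoothRing.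

(** The operations are locked: otherwise testing two elements for equality
    would unfold down to limits. *)
HB.lock Definition sfn (R : realType) (n : nat) (D : region R n)
  (f : 'rV[R]_n -> R) (sf : smooth_on (region_set D) f) : smooth_fn D :=
  projT1 (sfn_key sf).

Lemma sfnE (R : realType) (n : nat) (D : region R n) (f : 'rV[R]_n -> R)
  (sf : smooth_on (region_set D) f) x : region_set D x -> sfn sf x = f x.
Proof. by rewrite sfn.unlock; exact: (projT2 (sfn_key sf)). Qed.

HB.lock Definition sfnD (R : realType) (n : nat) (D : region R n)
  (a b : smooth_fn D) : smooth_fn D :=
  sfn (smoothD (@region_open _ _ D) (fval_smooth a) (fval_smooth b)).

HB.lock Definition sfnN (R : realType) (n : nat) (D : region R n)
  (a : smooth_fn D) : smooth_fn D :=
  sfn (smoothN (@region_open _ _ D) (fval_smooth a)).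

HB.lock Definition sfnM (R : realType) (n : nat) (D : region R n)
  (a b : smooth_fn D) : smooth_fn D :=
  sfn (smoothM (@region_open _ _ D) (fval_smooth a) (fval_smooth b)).

HB.lock Definition sfnC (R : realType) (n : nat) (D : region R n) (c : R) :
  smooth_fn D := sfn (smooth_cst (@region_open _ _ D) c).

HB.lock Definition sfn_d (R : realType) (n : nat) (D : region R n) (i : 'I_n)
  (a : smooth_fn D) : smooth_fn D := sfn (smooth_partial i (fval_smooth a)).

Section SmoothRingStructure.
Variables (R : realType) (n : nat) (D : region R n).
Local Notation F := (smooth_fn D).
Local Notation U := (region_set D).
Let oU := @region_open _ _ D.

HB.instance Definition _ := gen_eqMixin F.
HB.instance Definition _ := gen_choiceMixin F.

Lemma sfnCE c x : U x -> sfnC D c x = c.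
Proof. rewrite sfnC.unlock; exact: sfnE. Qed.

Let sfn_unlock := (sfnD.unlock, sfnN.unlock, sfnM.unlock, sfnC.unlock).

Ltac sfn_eq :=
  move=> *; rewrite !sfn_unlock; apply: smooth_fn_ext => ? ?;
  do ?rewrite !sfnE //=.

Fact sfnDA : associative (@sfnD _ _ D).
Proof. sfn_eq; exact: addrA. Qed.
Fact sfnDC : commutative (@sfnD _ _ D).
Proof. sfn_eq; exact: addrC. Qed.
Fact sfn0D : left_id (sfnC D 0) (@sfnD _ _ D).
Proof. sfn_eq; exact: add0r. Qed.
Fact sfnND : left_inverse (sfnC D 0) (@sfnN _ _ D) (@sfnD _ _ D).
Proof. sfn_eq; exact: addNr. Qed.

HB.instance Definition _ := GRing.isZmodule.Build F sfnDA sfnDC sfn0D sfnND.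

Fact sfnMA : associative (@sfnM _ _ D).
Proof. sfn_eq; exact: mulrA. Qed.
Fact sfnMC : commutative (@sfnM _ _ D).
Proof. sfn_eq; exact: mulrC. Qed.
Fact sfn1M : left_id (sfnC D 1) (@sfnM _ _ D).
Proof. sfn_eq; exact: mul1r. Qed.
Fact sfnMDl : left_distributive (@sfnM _ _ D) (@sfnD _ _ D).
Proof. sfn_eq; exact: mulrDl. Qed.
Fact sfn1_neq0 : sfnC D 1 != (sfnC D 0).
Proof.
have [x Ux] := @region_neq0 _ _ D.
apply/eqP => /(congr1 (fun a : F => fval a x)) /eqP.
by rewrite !sfnCE // oner_eq0.
Qed.

HB.instance Definition _ := GRing.Zmodule_isComNzRing.Build F
  sfnMA sfnMC sfn1M sfnMDl sfn1_neq0.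

Lemma fval0 x : (0 : F) x = 0.
Proof.
by have [Ux|/fval_out->//] := pselect (U x); exact: sfnCE.
Qed.
Lemma fval1 x : U x -> (1 : F) x = 1.
Proof. exact: sfnCE. Qed.
Lemma fvalD (a b : F) x : (a + b : F) x = a x + b x.
Proof.
have [Ux|nUx] := pselect (U x).
  by have -> : (a + b)%R = sfnD a b by []; rewrite sfnD.unlock sfnE.
by rewrite !fval_out // addr0.
Qed.
Lemma fvalN (a : F) x : (- a : F) x = - a x.
Proof.
have [Ux|nUx] := pselect (U x).
  by have -> : (- a)%R = sfnN a by []; rewrite sfnN.unlock sfnE.
by rewrite !fval_out // oppr0.
Qed.
Lemma fvalM (a b : F) x : (a * b : F) x = a x * b x.
Proof.
have [Ux|nUx] := pselect (U x).
  by have -> : (a * b)%R = sfnM a b by []; rewrite sfnM.unlock sfnE.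
by rewrite !fval_out // mulr0.
Qed.

Lemma fval_sum I (r : seq I) (P : pred I) (f : I -> F) x :
  (\sum_(i <- r | P i) f i : F) x = \sum_(i <- r | P i) f i x.
Proof.
by elim/big_rec2: _ => [|i y a Pi <-]; rewrite ?fval0 ?fvalD.
Qed.

Lemma sfn_dE i (a : F) x : U x -> sfn_d i a x = partial i a x.
Proof. rewrite sfn_d.unlock; exact: sfnE. Qed.

Fact sfn_d_is_zmod_morphism (i : 'I_n) : zmod_morphism (@sfn_d _ _ D i).
Proof.
move=> a b; apply: smooth_fn_ext => x Ux.
rewrite (sfn_dE _ _ Ux) fvalD fvalN !(sfn_dE _ _ Ux).
rewrite (_ : fval (a - b) = fun y => a y + (\- fval b) y); last first.
  by apply/funext => y; rewrite fvalD fvalN.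
rewrite (partialD _ (fval_smooth a) (smoothN oU (fval_smooth b)) Ux).
by rewrite (partialN _ (fval_smooth b) Ux).
Qed.
HB.instance Definition _ (i : 'I_n) :=
  GRing.isZmodMorphism.Build F F (@sfn_d _ _ D i) (sfn_d_is_zmod_morphism i).

Lemma sfn_dM i (a b : F) : sfn_d i (a * b) = sfn_d i a * b + a * sfn_d i b.
Proof.
apply: smooth_fn_ext => x Ux; rewrite fvalD !fvalM !(sfn_dE _ _ Ux).
rewrite (_ : fval (a * b) = fun y => a y * b y); last first.
  by apply/funext => y; rewrite fvalM.
exact: (partialM _ (fval_smooth a) (fval_smooth b) Ux).
Qed.

Lemma sfn_dC i j (a : F) : sfn_d i (sfn_d j a) = sfn_d j (sfn_d i a).
Proof.
apply: smooth_fn_ext => x Ux.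
rewrite !(sfn_dE _ _ Ux).
rewrite (eq_partial oU i (fun y => @sfn_dE j a y) Ux).
rewrite (eq_partial oU j (fun y => @sfn_dE i a y) Ux).
exact: (partialC oU _ _ (fval_smooth a)).
Qed.

Lemma partial_sfn i f (a : F) x : (forall y, U y -> a y = f y) -> U x ->
  partial i f x = sfn_d i a x.
Proof.
move=> af Ux; rewrite (sfn_dE _ _ Ux).
by apply: (eq_partial oU _ _ Ux) => y Uy; rewrite af.
Qed.

(** The algebraic objects over the ring of smooth functions, evaluated at a
    point of the domain, are the coordinate expressions of Riemannian
    geometry. *)
Section Transfer.
Variables (g : 'rV[R]_n -> 'M[R]_n) (f : 'rV[R]_n -> R).
Hypotheses (sg : forall i j, smooth_on U (fun x => g x i j))
  (gsym : forall x, U x -> (g x)^T = g x) (gunit : forall x, U x -> g x \in unitmx)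
  (sf : smooth_on U f).

Let dF : 'I_n -> {additive F -> F} := fun i => @sfn_d _ _ D i.
Let G : 'M[F]_n := \matrix_(i, j) sfn (sg i j).
Let H : 'M[F]_n := \matrix_(i, j) sfn (smooth_invmx oU sg gunit i j).
Let u : F := sfn sf.
Let half : F := sfnC D 2^-1.

Let GE i j x : U x -> G i j x = g x i j.
Proof. by move=> Ux; rewrite mxE sfnE. Qed.
Let HE i j x : U x -> H i j x = invmx (g x) i j.
Proof. by move=> Ux; rewrite mxE sfnE. Qed.
Let uE x : U x -> u x = f x.
Proof. exact: sfnE. Qed.

Let Gsym : G^T = G.
Proof.
apply/matrixP => i j; rewrite mxE; apply: smooth_fn_ext => x Ux.
by rewrite !GE // -{1}gsym // mxE.
Qed.

Let HG : H *m G = 1%:M.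
Proof.
apply/matrixP => i j; rewrite !mxE; apply: smooth_fn_ext => x Ux.
rewrite fval_sum; under eq_bigr => k _ do rewrite fvalM HE // GE //.
have /matrixP/(_ i j) := mulVmx (gunit Ux); rewrite !mxE => ->.
by case: eqP => _; rewrite ?fval1 // fval0.
Qed.

Let half2 : half + half = 1.
Proof.
apply: smooth_fn_ext => x Ux; rewrite fvalD fval1 // !sfnCE //.
lra.
Qed.

Let A := conn dF G H half.

Let AE i k j x : U x -> A i k j x = christoffel g k i j x.
Proof.
move=> Ux; rewrite /A /conn mxE fvalM sfnCE // /christoffel; congr (_ * _).
rewrite fval_sum; apply: eq_bigr => l _.
rewrite fvalM HE // !(fvalD, fvalN); congr (_ * (_ + _ - _)).
- by symmetry; apply: (partial_sfn _ _ Ux) => y Uy; rewrite GE.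
- by symmetry; apply: (partial_sfn _ _ Ux) => y Uy; rewrite GE.
- by symmetry; apply: (partial_sfn _ _ Ux) => y Uy; rewrite GE.
Qed.

Let ricE j k x : U x -> ric dF G H half j k x = ricci g x j k.
Proof.
move=> Ux; rewrite /ric /ricci [RHS]mxE [X in fval X]mxE fval_sum.
apply: eq_bigr => i _.
rewrite /curv /riemann -/A !mxDNE !mxME !(fvalD, fvalN) -addrA.
congr (_ - _ + _).
- by rewrite mxE; symmetry; apply: (partial_sfn _ _ Ux) => y Uy; exact: AE.
- by rewrite mxE; symmetry; apply: (partial_sfn _ _ Ux) => y Uy; exact: AE.
rewrite !fval_sum -sumrB; apply: eq_bigr => p _.
by rewrite !fvalM !(AE _ _ _ Ux).
Qed.

Let duE j x : U x -> sfn_d j u x = partial j f x.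
Proof. by move=> Ux; symmetry; apply: partial_sfn => // y Uy; rewrite uE. Qed.

Let hessE i j x : U x -> hess dF G H half u i j x = hessian g f x i j.
Proof.
move=> Ux; rewrite /hess /hessian -/A [RHS]mxE [X in fval X]mxE fvalD fvalN.
congr (_ - _).
  by symmetry; apply: (partial_sfn _ _ Ux) => y Uy; rewrite duE.
rewrite fval_sum; apply: eq_bigr => p _.
by rewrite fvalM AE // duE.
Qed.

Let lapE x : U x -> lap dF G H half u x = laplacian g f x.
Proof.
move=> Ux; rewrite /lap /laplacian /mxtrace fval_sum; apply: eq_bigr => i _.
rewrite mxE fval_sum; apply: eq_bigr => j _.
have -> : H j i = H i j by rewrite -{1}(Hsym Gsym HG) mxE.
by rewrite fvalM HE // hessE // mulrC.
Qed.

Let gradsqE x : U x -> gradsq dF H u x = sqnorm g (gradient g f) x.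
Proof.
move=> Ux; rewrite /gradsq fval_sum sqnorm_gradient; last exact: gunit.
apply: eq_bigr => l _; rewrite fval_sum; apply: eq_bigr => p _.
by rewrite !fvalM (HE _ _ Ux) !(duE _ Ux).
Qed.

Definition first_integral (m lambda : R) x : R :=
  lambda * f x ^+ 2 + f x * laplacian g f x + (m - 1) * sqnorm g (gradient g f) x.

(** [soliton_first_integral] in the ring of smooth functions. *)
Theorem first_integral_closed (m lambda : R) : m != 0 ->
    (forall x, U x -> f x != 0) ->
    (forall x, U x -> ricci g x - (m / f x) *: hessian g f x = lambda *: g x) ->
  smooth_on U (first_integral m lambda) /\
  forall i x, U x -> partial i (first_integral m lambda) x = 0.
Proof.
move=> m0 f0 sol.
pose v : F := sfn (smoothV oU f0 sf).
pose C := @sfnC _ _ D.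
have CE c x : U x -> C c x = c by exact: sfnCE.
have dC0 c i : sfn_d i (C c) = 0.
  apply: smooth_fn_ext => x Ux; rewrite fval0 -(partial_cst i c x).
  by symmetry; apply: (partial_sfn _ _ Ux) => y Uy; rewrite CE.
have C1 : C 1 = 1 by apply: smooth_fn_ext => x Ux; rewrite CE // fval1.
pose K : F := C lambda * u ^+ 2 + u * lap dF G H half u
              + (C m - 1) * gradsq dF H u.
have KE x : U x -> K x = first_integral m lambda x.
  move=> Ux; rewrite /K /first_integral !(fvalD, fvalM, fvalN) !CE //.
  by rewrite ?fval1 // uE // lapE // gradsqE.
have dK : forall i, sfn_d i K = 0.
  apply: (soliton_first_integral sfn_dM sfn_dC Gsym HG half2
     (v := v) (minv := C m^-1)).
  - apply: smooth_fn_ext => x Ux.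
    by rewrite fvalM uE // sfnE // fval1 // mulfV // f0.
  - by apply: smooth_fn_ext => x Ux; rewrite fvalM !CE // ?fval1 // mulfV.
  - exact: dC0.
  - exact: dC0.
  apply/matrixP => j k; apply: smooth_fn_ext => x Ux.
  rewrite ricE // mxDE fvalD !mxZE !fvalM !CE // GE // hessE // sfnE //.
  have /eqP := sol x Ux; rewrite subr_eq => /eqP ->.
  by rewrite mxDE !mxZE.
split; first exact: (eq_smooth oU KE (fval_smooth K)).
move=> i x Ux; rewrite (partial_sfn i KE Ux) dK; exact: fval0.
Qed.

End Transfer.
End SmoothRingStructure.

(** * Behaviour under a change of coordinates *)

Section ChangeOfCoordinates.
Variables (F : fieldType) (n : nat).
Hypothesis F2 : 2 != 0 :> F.

(** The Christoffel symbols as a function of the values at one point of the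
    inverse metric and of the first derivatives of the metric. *)
Definition christoffel_of (H : 'M[F]_n) (dG : 'I_n -> 'M[F]_n) (k i j : 'I_n) : F :=
  2^-1 * \sum_l H k l * (dG i j l + dG j i l - dG l i j).

(* Values at one point: J is the Jacobian of the transition map, S p its
   derivative in the direction p, G and G' are the metrics in the two charts,
   H and H' their inverses. *)
Variables (J G G' H H' : 'M[F]_n) (S dG dG' : 'I_n -> 'M[F]_n).
Hypotheses (G'sym : G'^T = G') (HG : H *m G = 1%:M) (HG' : H' *m G' = 1%:M)
  (GE : G = J *m G' *m J^T) (SC : forall p i k, S p i k = S i p k)
  (dGE : forall p, dG p = S p *m G' *m J^T
     + J *m (\sum_r J p r *: dG' r) *m J^T + J *m G' *m (S p)^T).

Lemma inverse_metric_change : J^T *m H *m J = H'.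
Proof.
have JX : J *m (G' *m J^T *m H) = 1%:M by rewrite !mulmxA -GE (mulmx1C HG).
by rewrite -[LHS]mul1mx -HG' -mulmxA !mulmxA -[X in X = _]mul1mx -!mulmxA
  [G' *m _]mulmxA [G' *m _ *m _]mulmxA (mulmx1C JX) mulmx1 mul1mx.
Qed.

(** Differentiate G = J G' J^T.  The second derivatives S of the transition map
    enter dG twice; in the alternating sum over the three index positions all of
    them cancel except those with both lower indices i, j. *)
Lemma lowered_change l i j : dG i j l + dG j i l - dG l i j =
  \sum_r J l r * (2%:R * (S i *m G') j r
    + \sum_p \sum_q J i p * J j q * (dG' p q r + dG' q p r - dG' r p q)).
Proof.
have BE p a b : (J *m G' *m (S p)^T) a b = (S p *m G' *m J^T) b a.
  have -> : J *m G' *m (S p)^T = (S p *m G' *m J^T)^T.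
    by rewrite !trmx_mul trmxK G'sym mulmxA.
  by rewrite mxE.
have BC p a b : (S p *m G' *m J^T) a b = (S a *m G' *m J^T) p b.
  rewrite -!mulmxA !mxE; apply: eq_bigr => k _; by rewrite SC.
have CE p a b : (J *m (\sum_r J p r *: dG' r) *m J^T) a b =
    \sum_r \sum_s \sum_t J p r * J a s * J b t * dG' r s t.
  rewrite mulmx_sumr mulmx_suml summxE; apply: eq_bigr => r _.
  rewrite -scalemxAr -scalemxAl mxE -mulmxA mxE mulr_sumr; apply: eq_bigr => s _.
  rewrite mxE !mulr_sumr; apply: eq_bigr => t _; rewrite mxE; ring.
have DE p a b : dG p a b = (S p *m G' *m J^T) a b + (S p *m G' *m J^T) b a
    + \sum_r \sum_s \sum_t J p r * J a s * J b t * dG' r s t.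
  by rewrite dGE -CE -(BE p a b) !mxDE; ring.
rewrite !DE (BC i l j) (BC j l i) (BC i j l).
rewrite [X in _ + (_ + X) - _ = _](_ : _ = \sum_r \sum_s \sum_t
    J i r * J j s * J l t * dG' s r t); last first.
  rewrite exchange_big; do 3!(apply: eq_bigr => ? _); ring.
rewrite [X in _ - (_ + X) = _](_ : _ = \sum_r \sum_s \sum_t
    J i r * J j s * J l t * dG' t r s); last first.
  rewrite exchange_big; apply: eq_bigr => r _ /=.
  rewrite exchange_big; apply: eq_bigr => s _ /=.
  apply: eq_bigr => t _; ring.
under [RHS]eq_bigr => r _ do rewrite mulrDr.
rewrite big_split /=.
have -> : \sum_r J l r * (2%:R * (S i *m G') j r) =
    2%:R * (S j *m G' *m J^T) i l.
  rewrite -BC mxE mulr_sumr; apply: eq_bigr => r _; rewrite [J^T r l]mxE; ring.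
have -> : \sum_r J l r * (\sum_p \sum_q J i p * J j q *
       (dG' p q r + dG' q p r - dG' r p q)) =
  \sum_r \sum_s \sum_t J i r * J j s * J l t * dG' r s t
  + \sum_r \sum_s \sum_t J i r * J j s * J l t * dG' s r t
  - \sum_r \sum_s \sum_t J i r * J j s * J l t * dG' t r s.
  rewrite -big_split -sumrB /=.
  under eq_bigr => r _ do rewrite mulr_sumr.
  rewrite exchange_big; apply: eq_bigr => p _ /=.
  rewrite -big_split -sumrB /=.
  under eq_bigr => r _ do rewrite mulr_sumr.
  rewrite exchange_big; apply: eq_bigr => q _ /=.
  rewrite -big_split -sumrB /=; apply: eq_bigr => r _; ring.
ring.
Qed.

(** Inhomogeneous transformation law of the Christoffel symbols.  It is stated
    without the inverse of J: raising the index with H and then applying J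
    amounts to raising it with H' by [inverse_metric_change]. *)
Lemma christoffel_change s i j : \sum_k J k s * christoffel_of H dG k i j =
  S i j s + \sum_p \sum_q J i p * J j q * christoffel_of H' dG' s p q.
Proof.
pose L r := 2%:R * (S i *m G') j r
    + \sum_p \sum_q J i p * J j q * (dG' p q r + dG' q p r - dG' r p q).
transitivity (2^-1 * \sum_r H' s r * L r).
  rewrite mulr_sumr -inverse_metric_change.
  under [RHS]eq_bigr => r _ do rewrite mxE mulr_suml mulr_sumr.
  transitivity (\sum_k \sum_l J k s * (2^-1 * (H k l * \sum_r J l r * L r))).
    apply: eq_bigr => k _; rewrite /christoffel_of mulr_sumr mulr_sumr.
    by apply: eq_bigr => l _; rewrite lowered_change.
  rewrite exchange_big [RHS]exchange_big; apply: eq_bigr => l _ /=.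
  under [RHS]eq_bigr => r _ do rewrite [X in X * _ * _]mxE !mulr_suml mulr_sumr.
  rewrite [RHS]exchange_big; apply: eq_bigr => k _ /=.
  rewrite !mulr_sumr; apply: eq_bigr => r _; rewrite [J^T s k]mxE; ring.
under eq_bigr => r _ do rewrite mulrDr.
rewrite big_split mulrDr /=; congr (_ + _).
  have -> : \sum_r H' s r * (2%:R * (S i *m G') j r) = 2%:R * (S i *m G' *m H') j s.
    rewrite mxE mulr_sumr; apply: eq_bigr => r _.
    have -> : H' s r = H' r s.
      have H'sym : H'^T = H'.
        have GHt : G' *m H'^T = 1%:M by rewrite -{1}G'sym -trmx_mul HG' trmx1.
        by rewrite -[LHS]mul1mx -HG' -mulmxA GHt mulmx1.
      by rewrite -{1}H'sym mxE.
    ring.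
  by rewrite -mulmxA (mulmx1C HG') mulmx1 mulrA mulVf // mul1r.
transitivity (\sum_r \sum_p \sum_q J i p * J j q *
    (2^-1 * (H' s r * (dG' p q r + dG' q p r - dG' r p q)))).
  rewrite mulr_sumr; apply: eq_bigr => r _; rewrite !mulr_sumr.
  apply: eq_bigr => p _; rewrite !mulr_sumr; apply: eq_bigr => q _; ring.
rewrite exchange_big; apply: eq_bigr => p _ /=.
rewrite exchange_big; apply: eq_bigr => q _ /=.
by rewrite /christoffel_of !mulr_sumr.
Qed.

Definition hess_of (H0 : 'M[F]_n) dG0 (du0 : 'I_n -> F) (ddu0 : 'I_n -> 'I_n -> F) : 'M[F]_n :=
  \matrix_(i, j) (ddu0 i j - \sum_k christoffel_of H0 dG0 k i j * du0 k).

Variables (du du' : 'I_n -> F) (ddu ddu' : 'I_n -> 'I_n -> F).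
Hypotheses (duE : forall i, du i = \sum_k J i k * du' k)
  (dduE : forall i j, ddu i j =
     \sum_k (S i j k * du' k + J j k * \sum_r J i r * ddu' r k)).

(** The Hessian is a tensor: the term with S in the second derivatives of a
    function is the one in [christoffel_change]. *)
Lemma hess_change : hess_of H dG du ddu = J *m hess_of H' dG' du' ddu' *m J^T.
Proof.
apply/matrixP => i j; rewrite [LHS]mxE.
have -> : \sum_k christoffel_of H dG k i j * du k = \sum_s (S i j s +
    \sum_p \sum_q J i p * J j q * christoffel_of H' dG' s p q) * du' s.
  under eq_bigr => k _ do rewrite duE mulr_sumr.
  rewrite exchange_big; apply: eq_bigr => s _ /=.
  rewrite -christoffel_change mulr_suml; apply: eq_bigr => k _; ring.
rewrite dduE -sumrB -mulmxA mxE.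
transitivity (\sum_k (J j k * \sum_r J i r * ddu' r k -
   \sum_p \sum_q J i p * J j q * (christoffel_of H' dG' k p q * du' k))).
  apply: eq_bigr => k _; rewrite mulrDl opprD addrACA subrr add0r.
  congr (_ - _); rewrite mulr_suml; apply: eq_bigr => p _.
  by rewrite mulr_suml; apply: eq_bigr => q _; ring.
rewrite sumrB.
transitivity (\sum_p \sum_q J i p * J j q * 
    (ddu' p q - \sum_k christoffel_of H' dG' k p q * du' k)); last first.
  apply: eq_bigr => p _; rewrite mxE mulr_sumr; apply: eq_bigr => q _.
  rewrite !mxE; ring.
under [RHS]eq_bigr => p _ do (under eq_bigr => q _ do rewrite mulrBr; rewrite sumrB).
rewrite sumrB; congr (_ - _).
  under eq_bigr => k _ do rewrite mulr_sumr.
  rewrite exchange_big; do 2!(apply: eq_bigr => ? _ /=); ring.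
rewrite exchange_big; apply: eq_bigr => p _ /=.
rewrite exchange_big; apply: eq_bigr => q _ /=.
by rewrite mulr_sumr.
Qed.

Lemma trace_change : \tr (H *m hess_of H dG du ddu) = \tr (H' *m hess_of H' dG' du' ddu').
Proof.
rewrite hess_change -inverse_metric_change !mulmxA mxtrace_mulC !mulmxA.
by [].
Qed.

Lemma gradsq_change : \sum_i \sum_j H i j * du i * du j = \sum_i \sum_j H' i j * du' i * du' j.
Proof.
pose w : 'rV[F]_n := \row_i du i; pose w' : 'rV[F]_n := \row_i du' i.
have E (H0 : 'M[F]_n) (v0 : 'I_n -> F) :
    \sum_i \sum_j H0 i j * v0 i * v0 j = ((\row_i v0 i) *m H0 *m (\row_i v0 i)^T) 0 0.
  rewrite -mulmxA mxE; apply: eq_bigr => i _; rewrite !mxE mulr_sumr.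
  apply: eq_bigr => j _; rewrite !mxE; ring.
have wE : \row_i du i = w' *m J^T.
  by apply/rowP => i; rewrite !mxE duE; apply: eq_bigr => k _; rewrite !mxE mulrC.
by rewrite !E wE -inverse_metric_change trmx_mul trmxK !mulmxA.
Qed.

End ChangeOfCoordinates.

Section Charts.
Variables (R : realType) (n : nat) (M : smooth_manifold R n).
Implicit Types (a b : atlas M) (p : M) (x : 'rV[R]_n).

Local Notation chrt := (@chart_of R n M).

Lemma param_cvg a x : cod (chrt a) x -> {for x, continuous (param (chrt a))}.
Proof.
move=> cx; have := @param_continuous _ _ _ (chrt a).
by rewrite (continuous_open_subspace _ (@open_cod _ _ _ (chrt a))); apply; rewrite inE.
Qed.

Lemma coord_cvg a p : dom (chrt a) p -> {for p, continuous (Defs.coord (chrt a))}.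
Proof.
move=> dp; have := @Defs.coord_continuous _ _ _ (chrt a).
by rewrite (continuous_open_subspace _ (@open_dom _ _ _ (chrt a))); apply; rewrite inE.
Qed.

Lemma near_chart a p (P : set 'rV[R]_n) : dom (chrt a) p ->
    (\forall x \near Defs.coord (chrt a) p, P x) ->
  \forall q \near p, dom (chrt a) q /\ P (Defs.coord (chrt a) q).
Proof.
move=> dp Pn; apply: filterI; first exact: (open_nbhs_nbhs (conj (@open_dom _ _ _ (chrt a)) dp)).
exact: (coord_cvg dp).
Qed.

Lemma near_param a x (P : set M) : cod (chrt a) x ->
    (\forall p \near param (chrt a) x, P p) ->
  \forall y \near x, P (param (chrt a) y).
Proof. by move=> cx Pn; exact: (param_cvg cx). Qed.

Lemma open_overlap a b : open (overlap (chrt a) (chrt b)).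
Proof.
rewrite openE => x [cx dx]; apply: nbhsI_rV.
  exact: (open_nbhs_nbhs (conj (@open_cod _ _ _ (chrt a)) cx)).
apply: (near_param cx); exact: (open_nbhs_nbhs (conj (@open_dom _ _ _ (chrt b)) dx)).
Qed.

Lemma overlap_coord a b p : dom (chrt a) p -> dom (chrt b) p ->
  overlap (chrt a) (chrt b) (Defs.coord (chrt a) p).
Proof. by move=> ap bp; split; [exact: coordP|rewrite coordK]. Qed.

Lemma transition_cod a b x : overlap (chrt a) (chrt b) x ->
  cod (chrt b) (transition (chrt a) (chrt b) x).
Proof. by move=> [cx dx]; exact: coordP. Qed.

Variable g : riemannian_metric M.

(** A vector in the kernel would have norm zero. *)
Lemma metric_unit a x : cod (chrt a) x -> g a x \in unitmx.
Proof.
move=> cx; rewrite unitmxE unitfE; apply/negP => /det0P[v v0 vg].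
by have := metric_posdef g cx v0; rewrite vg mul0mx mxE ltxx.
Qed.

Variable u : M -> R.
Hypothesis su : smooth_fun u.

Section Change.
Variables (a b : atlas M) (x : 'rV[R]_n).
Hypothesis Wx : overlap (chrt a) (chrt b) x.

Let W := overlap (chrt a) (chrt b).
Let oW : open W := open_overlap (a := a) (b := b).
Let V := cod (chrt b).
Let oV : open V := @open_cod _ _ _ (chrt b).
Let tau := transition (chrt a) (chrt b).
Let J := jacobian_mx (chrt a) (chrt b).
Let y := tau x.
Let Vy : V y := transition_cod Wx.
Let st k : smooth_on W (fun x => tau x 0 k) := @atlas_smooth _ _ M a b k.
Let S (i : 'I_n) : 'M[R]_n := partial_mx i J x.

Let JE z i k : J z i k = partial i (fun w => tau w 0 k) z.
Proof. by rewrite mxE. Qed.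

Let sJ i k : smooth_on W (fun z => J z i k).
Proof.
by apply: (eq_smooth oW) (smooth_partial i (st k)) => z _; rewrite JE.
Qed.

Let SE (p i k : 'I_n) : S p i k = partial p (partial i (fun w => tau w 0 k)) x.
Proof.
by rewrite mxE; apply: (eq_partial oW p) Wx => z _; exact: JE.
Qed.

Let SC (p i k : 'I_n) : S p i k = S i p k.
Proof.
exact: (etrans (SE p i k) (etrans (partialC oW p i (st k) Wx) (esym (SE i p k)))).
Qed.

Let dcomp f i : smooth_on V f -> derivable (fun z => f (tau z)) x (basis_vec R i).
Proof. by move=> sf; exact: (derivable_comp oV st sf Wx Vy). Qed.

Let pcomp f i : smooth_on V f ->
  partial i (fun z => f (tau z)) x = \sum_k J x i k * partial k f y.
Proof.
move=> sf; rewrite (partial_comp oV _ st sf Wx Vy).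
by apply: eq_bigr => k _; rewrite JE.
Qed.

Let dGE (p : 'I_n) : partial_mx p (g a) x = S p *m g b y *m (J x)^T
  + J x *m (\sum_r J x p r *: partial_mx r (g b) y) *m (J x)^T
  + J x *m g b y *m (S p)^T.
Proof.
have dJ : derivable_entries p J x.
  by move=> k l; exact: (smooth_derivable (sJ k l) Wx).
have dJt : derivable_entries p (fun z => (J z)^T) x.
  move=> k l; have -> : (fun z => (J z)^T k l) = (fun z => J z l k).
    by apply/funext => z; rewrite mxE.
  exact: (smooth_derivable (sJ l k) Wx).
have dg : derivable_entries p (fun z => g b (tau z)) x.
  by move=> k l; exact: (dcomp (@metric_smooth _ _ _ g b k l)).
have E1 : partial_mx p (fun z => (J z)^T) x = (S p)^T.
  apply/matrixP => k l; rewrite !mxE; congr (partial p _ x).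
  by apply/funext => z; rewrite mxE.
have E2 : partial_mx p (fun z => g b (tau z)) x =
    \sum_r J x p r *: partial_mx r (g b) y.
  apply/matrixP => k l; rewrite mxE summxE.
  rewrite (pcomp p (@metric_smooth _ _ _ g b k l)).
  by apply: eq_bigr => r _; rewrite !mxE.
have -> : partial_mx p (g a) x =
    partial_mx p (fun z => J z *m g b (tau z) *m (J z)^T) x.
  apply/matrixP => k l; rewrite [LHS]mxE [RHS]mxE.
  by apply: (eq_partial oW p _ Wx) => z Wz; rewrite (metric_change g Wz).
rewrite (partial_mulmx (derivable_mulmx dJ dg) dJt) (partial_mulmx dJ dg).
by rewrite E1 E2 mulmxDl.
Qed.

Let ua := local_rep a u.
Let ub := local_rep b u.

Let sub : smooth_on V ub := @su b.

Let uE z : W z -> ua z = ub (tau z).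
Proof. by move=> [cz dz]; rewrite /ua /ub /local_rep /tau /transition coordK. Qed.

Let duE z i : W z -> partial i ua z = \sum_k J z i k * partial k ub (tau z).
Proof.
move=> Wz; rewrite (eq_partial oW i uE Wz).
rewrite (partial_comp oV _ st sub Wz (transition_cod Wz)).
by apply: eq_bigr => k _; rewrite JE.
Qed.

Let dduE i j : partial i (partial j ua) x =
  \sum_k (S i j k * partial k ub y
          + J x j k * \sum_r J x i r * partial r (partial k ub) y).
Proof.
rewrite (eq_partial oW i (fun z Wz => duE j Wz) Wx).
have -> : (fun z => \sum_k J z j k * partial k ub (tau z)) =
   (fun z => ((\row_k J z j k) *m (\col_k partial k ub (tau z))) 0 0).
  apply/funext => z; rewrite mxE; apply: eq_bigr => k _; by rewrite !mxE.
have dA : derivable_entries i (fun z => \row_k J z j k) x.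
  move=> k l; have -> : (fun z => (\row_k J z j k) k l) = (fun z => J z j l).
    by apply/funext => z; rewrite mxE.
  exact: (smooth_derivable (sJ j l) Wx).
have dB : derivable_entries i (fun z => \col_k partial k ub (tau z)) x.
  move=> k l; have -> : (fun z => (\col_k partial k ub (tau z)) k l) =
      (fun z => partial k ub (tau z)).
    by apply/funext => z; rewrite mxE.
  exact: (dcomp (smooth_partial k sub)).
have /matrixP/(_ 0 0) := partial_mulmx dA dB.
rewrite [LHS in LHS = _ -> _]mxE => ->.
rewrite mxDE !mxME -big_split; apply: eq_bigr => k _ /=.
have -> : partial_mx i (fun z => \row_k J z j k) x 0 k = S i j k.
  by rewrite [LHS]mxE [RHS]mxE; congr (partial i _ x); apply/funext => z; rewrite mxE.
have -> : partial_mx i (fun z => \col_k partial k ub (tau z)) x k 0 =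
    \sum_r J x i r * partial r (partial k ub) y.
  rewrite mxE -(pcomp i (smooth_partial k sub)); congr (partial i _ x).
  by apply/funext => z; rewrite mxE.
by congr (_ * _ + _ * _); rewrite mxE.
Qed.

Let HG : invmx (g a x) *m g a x = 1%:M.
Proof. by apply: mulVmx; exact: (metric_unit (proj1 Wx)). Qed.

Let HG' : invmx (g b y) *m g b y = 1%:M.
Proof. by apply: mulVmx; exact: metric_unit. Qed.

Let two_neq0 : 2 != 0 :> R. Proof. by rewrite pnatr_eq0. Qed.

Lemma sqnorm_change :
  sqnorm (g a) (gradient (g a) ua) x = sqnorm (g b) (gradient (g b) ub) y.
Proof.
rewrite !sqnorm_gradient; [|exact: metric_unit|exact: (metric_unit (proj1 Wx))].
exact: (gradsq_change HG HG' (metric_change g Wx) (fun i => duE i Wx)).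
Qed.

Lemma laplacian_hess_of (h : 'rV[R]_n -> 'M[R]_n) (f : 'rV[R]_n -> R) z :
    h z \in unitmx -> (h z)^T = h z ->
  laplacian h f z = \tr (invmx (h z) *m hess_of (invmx (h z))
    (fun i => partial_mx i h z) (fun k => partial k f z)
    (fun i j => partial i (partial j f) z)).
Proof.
move=> hu hs; rewrite /laplacian /mxtrace exchange_big; apply: eq_bigr => i _ /=.
rewrite mxE; apply: eq_bigr => j _; congr (_ * _).
  by rewrite -[in RHS]hs -trmx_inv mxE.
rewrite [LHS]mxE [RHS]mxE; congr (_ - _); apply: eq_bigr => k _; congr (_ * _).
rewrite /christoffel /christoffel_of; congr (_ * _); apply: eq_bigr => l _.
by congr (_ * (_ + _ - _)); rewrite mxE.
Qed.

Lemma laplacian_change : laplacian (g a) ua x = laplacian (g b) ub y.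
Proof.
have gs := Defs.metric_sym g Vy.
have Ea := laplacian_hess_of ua (metric_unit (proj1 Wx)) (Defs.metric_sym g (proj1 Wx)).
have Eb := laplacian_hess_of ub (metric_unit Vy) gs.
refine (etrans Ea (etrans _ (esym Eb))).
exact: (trace_change two_neq0 gs HG HG' (metric_change g Wx) SC dGE
  (fun i => duE i Wx) dduE).
Qed.

End Change.
End Charts.

(** * The first integral is constant *)

(** A locally constant property holds everywhere on a connected space once it
    holds somewhere. *)
Lemma connected_clopen_ind (T : topologicalType) (Q : set T) (p0 : T) :
    connected [set: T] -> (forall p, \forall q \near p, Q q <-> Q p) ->
  Q p0 -> forall p, Q p.
Proof.
move=> cT loc Qp0 p.
have oQ : open Q.
  by rewrite openE => q Qq; have := loc q; apply: filterS => r /iffRL; apply.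
have cQ : closed Q.
  rewrite -[Q]setCK; apply: open_closedC; rewrite openE => q nQq.
  have := loc q; apply: filterS => r /iffLR rq Qr; exact: nQq (rq Qr).
have QT : Q = [set: T].
  apply: cT; first by exists p0.
  - by exists Q => //; rewrite setTI.
  - by exists Q => //; rewrite setTI.
by rewrite QT.
Qed.

Section FirstIntegral.
Variables (R : realType) (n : nat) (M : smooth_manifold R n).
Variables (g : riemannian_metric M) (u : M -> R).
Hypotheses (su : smooth_fun u) (u_pos : forall p : M, 0 < u p).
Variables (m lambda : R).
Hypotheses (m0 : m != 0) (sol : gradient_soliton g u m lambda).
Local Notation chrt := (@chart_of R n M).

Definition chart_region (a : atlas M) (p : M) (dp : dom (chrt a) p) : region R n :=
  @Region R n (cod (chrt a)) (@open_cod _ _ _ (chrt a))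
    (ex_intro _ (Defs.coord (chrt a) p) (@coordP _ _ _ (chrt a) p dp)).

Let I a p := lambda * u p ^+ 2 + u p * laplacian_at g u a p
       + (m - 1) * gradient_sqnorm_at g u a p.

Let IE a p : dom (chrt a) p -> I a p =
  first_integral (g a) (local_rep a u) m lambda (Defs.coord (chrt a) p).
Proof. by move=> dp; rewrite /first_integral {1 2}/local_rep coordK. Qed.

Let I_chart a b p : dom (chrt a) p -> dom (chrt b) p -> I a p = I b p.
Proof.
move=> ap bp; rewrite /I /laplacian_at /gradient_sqnorm_at.
have Wx := overlap_coord ap bp.
have E : transition (chrt a) (chrt b) (Defs.coord (chrt a) p) = Defs.coord (chrt b) p.
  by rewrite /transition coordK.
by rewrite (laplacian_change g su Wx) (sqnorm_change g su Wx) E.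
Qed.

Let I_local a p : dom (chrt a) p ->
  \forall q \near p, dom (chrt a) q /\ I a q = I a p.
Proof.
move=> dp; pose D := chart_region dp.
have unz x : cod (chrt a) x -> local_rep a u x != 0.
  by move=> _; rewrite gt_eqF // u_pos.
have [sI dI] : smooth_on (cod (chrt a)) (first_integral (g a) (local_rep a u) m lambda) /\
    forall i x, cod (chrt a) x -> partial i (first_integral (g a) (local_rep a u) m lambda) x = 0.
  apply: (@first_integral_closed R n D) => //.
  - exact: (@metric_smooth _ _ _ g a).
  - exact: (@Defs.metric_sym _ _ _ g a).
  - by move=> x cx; exact: metric_unit.
  - exact: su.
  - move=> x cx; have := soliton_eq sol (paramP cx).
    by rewrite /= paramK.
have := near_chart dp (locally_constant (@open_cod _ _ _ (chrt a)) sI dI (coordP dp)).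
by apply: filterS => q [dq E]; rewrite !IE.
Qed.

(** The property that all charts give the value at p0 is locally constant. *)
Theorem first_integral_constant : exists mu, forall p a, dom (chrt a) p -> I a p = mu.
Proof.
have [[p0 _]|M0] := pselect ([set: M] !=set0); last first.
  by exists 0 => p; case: M0; exists p.
have [a0 d0] := atlas_cover p0.
exists (I a0 p0) => p a dp.
pose Q := [set q : M | forall b, dom (chrt b) q -> I b q = I a0 p0].
suff : forall q, Q q by apply.
apply: (@connected_clopen_ind M Q p0 (@space_connected _ _ M)).
  move=> q; have [b db] := atlas_cover q.
  have := I_local db; apply: filterS => r [dr E]; split=> H c dc.
    by rewrite (I_chart dc db) -E H.
  by rewrite (I_chart dc dr) E H.
by move=> b db; exact: I_chart.
Qed.

End FirstIntegral.

(** * The strong maximum principle *)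

Section Forms.
Variable R : realFieldType.

Definition quad n (A : 'I_n -> 'I_n -> R) (v : 'I_n -> R) : R :=
  \sum_i \sum_j v i * v j * A i j.

Definition posdef n (A : 'I_n -> 'I_n -> R) :=
  forall v, (exists i, v i != 0) -> 0 < quad A v.

Lemma sum2_recl n (f : 'I_n.+1 -> 'I_n.+1 -> R) :
    (forall j, f ord0 j = 0) -> (forall i, f i ord0 = 0) ->
  \sum_i \sum_j f i j = \sum_i \sum_j f (lift ord0 i) (lift ord0 j).
Proof.
move=> f0 f0'; rewrite big_ord_recl big1 ?add0r //.
by apply: eq_bigr => i _; rewrite big_ord_recl f0' add0r.
Qed.

Lemma sum2_rank1 n (c : 'I_n -> R) (k : R) (v : 'I_n -> R) :
  \sum_i \sum_j v i * v j * (c i * c j * k) = (\sum_i v i * c i) ^+ 2 * k.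
Proof.
rewrite expr2 mulr_suml mulr_suml; apply: eq_bigr => i _.
rewrite mulr_sumr mulr_suml; apply: eq_bigr => j _; ring.
Qed.

(** The contraction of a positive definite form with a nonnegative one is
    nonnegative.  Completing the square in the first variable splits A into the
    rank-one form c c^T / a, whose contraction with B is a value of B, and a
    positive definite form in one variable less. *)
Lemma contract_ge0 n (A B : 'I_n -> 'I_n -> R) :
    (forall i j, A i j = A j i) -> posdef A -> (forall v, 0 <= quad B v) ->
  0 <= \sum_i \sum_j A i j * B i j.
Proof.
elim: n A B => [|n IH] A B Asym Apos Bpos; first by rewrite big_ord0.
pose a := A ord0 ord0; pose c i := A i ord0.
have a0 : 0 < a.
  have : 0 < quad A (fun i => (i == ord0)%:R) by apply: Apos; exists ord0; rewrite oner_eq0.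
  rewrite /quad (bigD1 ord0) //= [X in _ + X]big1 => [|i /negPf ->]; last first.
    by rewrite big1 // => j _; rewrite !mul0r.
  rewrite (bigD1 ord0) //= [X in _ + X + _]big1 => [|i /negPf ->]; last first.
    by rewrite mulr0 mul0r.
  by rewrite !addr0 !mul1r.
pose S i j := A i j - c i * c j * a^-1.
have AE i j : A i j = S i j + c i * c j * a^-1 by rewrite /S subrK.
have S0 j : S ord0 j = 0.
  by rewrite /S /c (Asym ord0 j) mulrAC mulfV ?mul1r ?subrr ?gt_eqF.
have S0' i : S i ord0 = 0.
  by rewrite /S /c -mulrA mulfV ?mulr1 ?subrr ?gt_eqF.
have -> : \sum_i \sum_j A i j * B i j =
   \sum_i \sum_j S (lift ord0 i) (lift ord0 j) * B (lift ord0 i) (lift ord0 j)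
   + quad B c * a^-1.
  rewrite -(@sum2_recl n (fun i j => S i j * B i j)); first last.
  - by move=> i; rewrite S0' mul0r.
  - by move=> j; rewrite S0 mul0r.
  rewrite /quad mulr_suml -big_split; apply: eq_bigr => i _ /=.
  rewrite mulr_suml -big_split; apply: eq_bigr => j _ /=.
  by rewrite AE; ring.
apply: addr_ge0; last by rewrite mulr_ge0 // invr_ge0 ltW.
apply: IH.
- by move=> i j; rewrite /S Asym mulrAC [c _ * _ * _]mulrAC; congr (_ - _); ring.
- move=> w [i0 wi0].
  (* The first coordinate that makes the rank-one part vanish on v. *)
  pose t := - (\sum_i w i * c (lift ord0 i)) / a.
  pose v (i : 'I_n.+1) := if unlift ord0 i is Some j then w j else t.
  have vl i : v (lift ord0 i) = w i by rewrite /v liftK.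
  have v0 : v ord0 = t by rewrite /v unlift_none.
  have : 0 < quad A v by apply: Apos; exists (lift ord0 i0); rewrite vl.
  have -> : quad A v = quad S v + (\sum_i v i * c i) ^+ 2 * a^-1.
    rewrite -sum2_rank1 /quad -big_split; apply: eq_bigr => i _ /=.
    by rewrite -big_split; apply: eq_bigr => j _ /=; rewrite AE mulrDr.
  have -> : \sum_i v i * c i = 0.
    rewrite big_ord_recl v0; under eq_bigr => i _ do rewrite vl.
    by rewrite /t /c -/a divfK ?gt_eqF // addNr.
  rewrite expr0n mul0r addr0 /quad sum2_recl; first last.
  - by move=> i; rewrite S0' mulr0.
  - by move=> j; rewrite S0 mulr0.
  by under eq_bigr => i _ do under eq_bigr => j _ do rewrite !vl.
- move=> w; pose v (i : 'I_n.+1) := if unlift ord0 i is Some j then w j else 0.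
  have vl i : v (lift ord0 i) = w i by rewrite /v liftK.
  have v0 : v ord0 = 0 by rewrite /v unlift_none.
  have := Bpos v; rewrite /quad sum2_recl; first last.
  - by move=> i; rewrite v0 mulr0 mul0r.
  - by move=> j; rewrite v0 !mul0r.
  by under eq_bigr => i _ do under eq_bigr => j _ do rewrite !vl.
Qed.

(** H = H G H, so the form H at v is the form G at v H. *)
Lemma posdef_invmx n (G : 'M[R]_n) : G^T = G -> G \in unitmx ->
    (forall v : 'rV[R]_n, v != 0 -> 0 < (v *m G *m v^T) 0 0) ->
  posdef (fun i j => invmx G i j).
Proof.
move=> Gs Gu Gpos v [i vi].
pose r : 'rV[R]_n := \row_i v i; pose w := r *m invmx G.
have Hs : (invmx G)^T = invmx G by rewrite trmx_inv Gs.
have w0 : w != 0.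
  apply/eqP => w0; have := mulmxKV Gu r; rewrite -/w w0 mul0mx => /rowP/(_ i).
  by rewrite !mxE => /esym/eqP; rewrite (negPf vi).
have := Gpos w w0; rewrite /w trmx_mul Hs mulmxKV // mulmxA /quad => H.
suff -> : \sum_i \sum_j v i * v j * invmx G i j = (r *m invmx G *m r^T) 0 0 by [].
rewrite -mulmxA mxE; apply: eq_bigr => k _; rewrite !mxE mulr_sumr.
by apply: eq_bigr => j _; rewrite !mxE; ring.
Qed.

End Forms.

Section Elliptic.
Variables (R : realType) (n : nat) (U : set 'rV[R]_n).
Hypothesis oU : open U.
Variables (a : 'I_n -> 'I_n -> 'rV[R]_n -> R) (b : 'I_n -> 'rV[R]_n -> R).
Hypotheses (asym : forall i j x, U x -> a i j x = a j i x)
  (apos : forall x, U x -> posdef (fun i j => a i j x))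
  (sa : forall i j, smooth_on U (a i j)) (sb : forall k, smooth_on U (b k)).
Implicit Types (f h : 'rV[R]_n -> R) (x y z : 'rV[R]_n).

Definition elliptic f x : R :=
  \sum_i \sum_j a i j x * partial i (partial j f) x + \sum_k b k x * partial k f x.

Lemma smooth_elliptic f : smooth_on U f -> smooth_on U (elliptic f).
Proof.
move=> sf; apply: (smoothD oU).
  apply: (smooth_sum oU) => i _; apply: (smooth_sum oU) => j _.
  by apply: (smoothM oU (sa i j)); apply: smooth_partial; exact: smooth_partial.
apply: (smooth_sum oU) => k _.
by apply: (smoothM oU (sb k)); exact: smooth_partial.
Qed.

Lemma ellipticD f h x : smooth_on U f -> smooth_on U h -> U x ->
  elliptic (fun y => f y + h y) x = elliptic f x + elliptic h x.
Proof.
move=> sf sh Ux.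
have E1 i y : U y -> partial i (fun y => f y + h y) y = partial i f y + partial i h y.
  by move=> Uy; rewrite (partialD i sf sh Uy).
have E2 i j : partial i (partial j (fun y => f y + h y)) x =
    partial i (partial j f) x + partial i (partial j h) x.
  rewrite (eq_partial oU i (fun y => E1 j y) Ux).
  exact: (partialD i (smooth_partial j sf) (smooth_partial j sh) Ux).
rewrite /elliptic addrACA; congr (_ + _).
  rewrite -big_split; apply: eq_bigr => i _ /=.
  rewrite -big_split; apply: eq_bigr => j _ /=.
  by rewrite E2 mulrDr.
by rewrite -big_split; apply: eq_bigr => k _ /=; rewrite (E1 k x Ux) mulrDr.
Qed.

Lemma ellipticZ c f x : smooth_on U f -> U x ->
  elliptic (fun y => c * f y) x = c * elliptic f x.
Proof.
move=> sf Ux; have sc := smooth_cst oU c.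
have E1 i h y : smooth_on U h -> U y ->
    partial i (fun y => c * h y) y = c * partial i h y.
  by move=> sh Uy; rewrite (partialM i sc sh Uy) partial_cst mul0r add0r.
have E2 i j : partial i (partial j (fun y => c * f y)) x = c * partial i (partial j f) x.
  rewrite (eq_partial oU i (fun y => @E1 j f y sf) Ux).
  exact: (E1 i _ x (smooth_partial j sf) Ux).
rewrite /elliptic mulrDr !mulr_sumr; congr (_ + _).
  apply: eq_bigr => i _; rewrite mulr_sumr; apply: eq_bigr => j _.
  by rewrite E2 mulrCA.
by apply: eq_bigr => k _; rewrite (E1 k f x sf Ux) mulrCA.
Qed.

(** At a zero of f only the principal part of the product rule survives. *)
Lemma elliptic_sqr f x : smooth_on U f -> U x -> f x = 0 ->
  elliptic (fun y => f y * f y) x = 2 * quad (fun i j => a i j x) (fun i => partial i f x).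
Proof.
move=> sf Ux fx0.
have E1 i y : U y -> partial i (fun y => f y * f y) y =
    partial i f y * f y + f y * partial i f y.
  by move=> Uy; rewrite (partialM i sf sf Uy).
have E2 i j : partial i (partial j (fun y => f y * f y)) x =
    2 * (partial i f x * partial j f x).
  rewrite (eq_partial oU i (fun y => E1 j y) Ux).
  have sp := smooth_partial j sf.
  rewrite (partialD i (smoothM oU sp sf) (smoothM oU sf sp) Ux).
  rewrite (partialM i sp sf Ux) (partialM i sf sp Ux) fx0.
  move: (partial i f x) (partial j f x) (partial i (partial j f) x) => p q r; ring.
rewrite /elliptic [X in _ + X]big1 => [|k _]; last first.
  by rewrite (E1 k x Ux) fx0 mulr0 mul0r addr0 mulr0.
rewrite addr0 /quad mulr_sumr; apply: eq_bigr => i _; rewrite mulr_sumr.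
apply: eq_bigr => j _; rewrite E2.
by move: (partial i f x) (partial j f x) (a i j x) => p q r; ring.
Qed.

(** Weak maximum principle: the gradient vanishes and the Hessian is
    nonpositive, hence so is its contraction with the principal part. *)
Lemma elliptic_local_max f x : smooth_on U f -> U x ->
  (\forall y \near x, f y <= f x) -> elliptic f x <= 0.
Proof.
move=> sf Ux fmax; rewrite /elliptic [X in _ + X]big1 => [|k _]; last first.
  by rewrite (partial_local_max oU k sf Ux fmax) mulr0.
rewrite addr0 -oppr_ge0.
have -> : - (\sum_i \sum_j a i j x * partial i (partial j f) x) =
    \sum_i \sum_j a i j x * (- partial i (partial j f) x).
  rewrite -sumrN; apply: eq_bigr => i _; rewrite -sumrN; apply: eq_bigr => j _.
  by rewrite mulrN.
apply: (@contract_ge0 R n (fun i j => a i j x) (fun i j => - partial i (partial j f) x)).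
- by move=> i j; exact: asym.
- exact: apos.
- move=> v; pose r : 'rV[R]_n := \row_i v i.
  have := hess_local_max oU r sf Ux fmax; rewrite -oppr_ge0 => /le_trans; apply.
  rewrite le_eqVlt; apply/orP; left; apply/eqP; rewrite /quad -sumrN.
  apply: eq_bigr => i _; rewrite -sumrN; apply: eq_bigr => j _.
  by rewrite !mxE mulrN.
Qed.

(** The topology comes from the sup norm, but spheres must be smooth for the
    barrier of Hopf, hence the Euclidean distance, squared. *)
Definition sqdist y : 'rV[R]_n -> R := fun x => \sum_i (x 0 i - y 0 i) * (x 0 i - y 0 i).

Lemma sqdist_ge0 y x : 0 <= sqdist y x.
Proof. by apply: sumr_ge0 => i _; rewrite -expr2 sqr_ge0. Qed.

Lemma sqdist_gt0 y x : x != y -> 0 < sqdist y x.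
Proof.
move=> xy; rewrite lt_neqAle sqdist_ge0 andbT eq_sym; apply: contra xy => /eqP E.
apply/eqP/rowP => i; apply/eqP; rewrite -subr_eq0 -sqrf_eq0 expr2.
have := E; move=> /eqP; rewrite psumr_eq0 => [/allP/(_ i)|j _]; last by rewrite -expr2 sqr_ge0.
by rewrite mem_index_enum => /(_ isT).
Qed.

Lemma sqdistxx y : sqdist y y = 0.
Proof. by apply: big1 => i _; rewrite subrr mul0r. Qed.

Lemma sqdist_norm y x : `|x - y| ^+ 2 <= sqdist y x.
Proof.
have [/eqP|n0] := eqVneq (`|x - y|) 0.
  by rewrite normr_eq0 => /eqP ->; rewrite normr0 expr0n sqdist_ge0.
have [[i j] E] : exists ij : 'I_1 * 'I_n, mx_norm (x - y) = `|(x - y) ij.1 ij.2|.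
  by apply: mx_norm_neq0.
rewrite [`|x - y|](_ : _ = `|(x - y) 0 j|); last by rewrite -(ord1 i).
rewrite real_normK ?num_real // /sqdist (bigD1 j) //= !mxE expr2 lerDl.
by apply: sumr_ge0 => k _; rewrite -expr2 sqr_ge0.
Qed.

Lemma smooth_sqdist y V : open V -> smooth_on V (sqdist y).
Proof.
move=> oV; have sc k : smooth_on V (fun x => x 0 k - y 0 k).
  by apply: (smoothD oV (smooth_coordinate k oV) (smooth_cst oV (- y 0 k))).
by apply: (smooth_sum oV) => k _; exact: (smoothM oV (sc k) (sc k)).
Qed.

Lemma partial_sqdist y x i : partial i (sqdist y) x = 2 * (x 0 i - y 0 i).
Proof.
have oT : open [set: 'rV[R]_n] by exact: openT.
have sc k : smooth_on [set: 'rV[R]_n] (fun x => x 0 k - y 0 k).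
  by apply: (smoothD oT (smooth_coordinate k oT) (smooth_cst oT (- y 0 k))).
have pc k : partial i (fun x => x 0 k - y 0 k) x = (k == i)%:R.
  rewrite (partialD i (smooth_coordinate k oT) (smooth_cst oT (- y 0 k)) I).
  by rewrite partial_cst addr0 partial_coordinate.
rewrite (@partial_sum _ _ _ oT i _ _ _ _ x (fun k _ => smoothM oT (sc k) (sc k)) I).
rewrite (bigD1 i) //= big1 => [|k /negPf ki].
  by rewrite (partialM i (sc i) (sc i) I) pc eqxx /=; ring.
by rewrite (partialM i (sc k) (sc k) I) pc ki /=; ring.
Qed.

Lemma continuous_sqdist y : continuous (sqdist y).
Proof. by move=> x; apply: (smooth_continuous (smooth_sqdist y openT)). Qed.

(** Continuity is only required on the closed set B, as the functions of
    interest are smooth on U only. *)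
Lemma closed_within_ge (B : set 'rV[R]_n) f (c : R) : closed B ->
  (forall x, B x -> {for x, continuous f}) -> closed (B `&` [set x | c <= f x]).
Proof.
move=> cB cf; rewrite -[_ `&` _]setCK; apply: open_closedC; rewrite openE => x.
have [Bx|nBx] := pselect (B x); last first.
  move=> _; have oC : open (~` B) by exact: closed_openC.
  have := open_nbhs_nbhs (conj oC nBx); apply: filterS => y nBy [By _]; exact: nBy.
move=> nP; have fx : f x < c by rewrite ltNge; apply/negP => cfx; apply: nP.
have : \forall y \near x, f y < c by exact: (cvgr_lt _ (cf x Bx)).
by apply: filterS => y yc [_ /=]; rewrite leNgt yc.
Qed.

Lemma closed_box z (r : R) : closed [set x : 'rV[R]_n | `|x - z| <= r].
Proof.
have -> : [set x : 'rV[R]_n | `|x - z| <= r] = closed_ball_ Num.norm z r.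
  by apply/seteqP; split => x /=; rewrite /closed_ball_ /= distrC.
exact: closed_closed_ball_.
Qed.

Lemma compact_in_box z (r : R) (B : set 'rV[R]_n) : closed B ->
  (forall x, B x -> `|x - z| <= r) -> compact B.
Proof.
move=> cB Br; apply: bounded_closed_compact => //.
exists (r + `|z|); split; first exact: num_real.
move=> N rN x /Br xr; apply: le_trans (ltW rN).
by rewrite -[x](subrK z); apply: le_trans (ler_normD _ _) _; rewrite lerD2r.
Qed.

End Elliptic.

Section StrongMaximum.
Variables (R : realType) (n : nat) (U : set 'rV[R]_n).
Hypothesis oU : open U.
Variables (a : 'I_n -> 'I_n -> 'rV[R]_n -> R) (b : 'I_n -> 'rV[R]_n -> R).
Hypotheses (asym : forall i j x, U x -> a i j x = a j i x)
  (apos : forall x, U x -> posdef (fun i j => a i j x))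
  (sa : forall i j, smooth_on U (a i j)) (sb : forall k, smooth_on U (b k)).
Variable v : 'rV[R]_n -> R.
Hypotheses (sv : smooth_on U v) (Lv : forall x, U x -> 0 <= elliptic a b v x).
Variable K : R.
Hypothesis vK : forall x, U x -> v x <= K.

Local Notation L := (elliptic a b).

(** Hopf's touching argument: a point z where v attains its upper bound K cannot
    lie on the boundary of a Euclidean ball, centred at y, inside which v < K.
    With D the defining function of the ball, which vanishes at z, the barrier
      w = al D^2 - D - |x - z|^2
    satisfies L w > 0 near z for large al, because L (D^2) is a positive
    multiple of the principal form at dD, and dD does not vanish at z.  Outside
    the ball, near z, w is negative except at z; inside, v < K.  So for small
    e > 0 the function v + e w, which equals K at z, stays below K on the
    boundary of a small box around z, and attains its maximum over the box at an
    interior point.  There L (v + e w) <= 0 by [elliptic_local_max], whereas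
    L v >= 0 and L w > 0. *)
Lemma hopf_touching z y (r : R) : 0 < r -> (forall x, `|x - z| <= r -> U x) ->
    v z = K -> z != y ->
    (forall x, `|x - z| <= r -> sqdist y x < sqdist y z -> v x < K) -> False.
Proof.
move=> r0 rU vz zy below.
have Uz : U z by apply: rU; rewrite subrr normr0 ltW.
pose D x := sqdist y x - sqdist y z.
have sD : smooth_on U D := smoothD oU (smooth_sqdist y oU) (smooth_cst oU (- sqdist y z)).
have Dz : D z = 0 by rewrite /D subrr.
have dD i : partial i D z = 2 * (z 0 i - y 0 i).
  rewrite (partialD i (smooth_sqdist y oU) (smooth_cst oU (- sqdist y z)) Uz).
  by rewrite partial_cst addr0 partial_sqdist.
pose q := quad (fun i j => a i j z) (fun i => partial i D z).
have q0 : 0 < q.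
  apply: apos => //.
  have [i zi] : exists i, z 0 i != y 0 i.
    apply: contrapT => H; move/eqP: zy; apply; apply/rowP => i; apply/eqP.
    by apply/negPn/negP => zi; apply: H; exists i.
  by exists i; rewrite dD mulf_neq0 ?pnatr_eq0 // subr_eq0.
have sQ := smooth_sqdist z oU.
have sE : smooth_on U (fun x => D x + sqdist z x) := smoothD oU sD sQ.
pose c := L (fun x => D x + sqdist z x) z.
(* L w = 2 al q - c at z, and 2 al q = |c| + 1. *)
pose al := (`|c| + 1) / (2 * q).
have al0 : 0 < al by rewrite divr_gt0 ?ltr_wpDl ?mulr_gt0.
have sDD : smooth_on U (fun x => D x * D x) := smoothM oU sD sD.
have sA : smooth_on U (fun x => al * (D x * D x)) := smoothM oU (smooth_cst oU al) sDD.
have sB : smooth_on U (fun x => -1 * (D x + sqdist z x)) :=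
  smoothM oU (smooth_cst oU (-1)) sE.
pose w x := al * (D x * D x) + -1 * (D x + sqdist z x).
have sw : smooth_on U w := smoothD oU sA sB.
have wz : w z = 0 by rewrite /w Dz sqdistxx; ring.
have Lwz : 0 < L w z.
  rewrite (ellipticD oU a b sA sB Uz) (ellipticZ oU a b al sDD Uz).
  rewrite (ellipticZ oU a b (-1) sE Uz) (elliptic_sqr oU a b sD Uz Dz) -/q -/c.
  rewrite /al mulrA -mulrA divfK; last by rewrite gt_eqF // mulr_gt0.
  by rewrite mulN1r subr_gt0 (le_lt_trans (ler_norm c)) // ltrDl.
(* The bound al D < 1 makes al D^2 - D <= 0 where D >= 0. *)
have [s [s0 sr sP]] : exists s, [/\ 0 < s, s <= r & forall x, `|x - z| <= s ->
    0 < L w x /\ al * D x < 1].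
  have n1 : \forall x \near z, 0 < L w x.
    exact: (cvgr_gt _ (smooth_continuous (smooth_elliptic oU sa sb sw) Uz)).
  have n2 : \forall x \near z, al * D x < 1.
    have sC : smooth_on U (fun x => al * D x) := smoothM oU (smooth_cst oU al) sD.
    apply: (cvgr_lt _ (smooth_continuous sC Uz)).
    by rewrite Dz mulr0 ltr01.
  have [t /= t0 tP] : nbhs_ball z [set x | 0 < L w x /\ al * D x < 1].
    by apply/nbhs_ballP; exact: nbhsI_rV n1 n2.
  exists (Num.min (t / 2) r); split.
  - by rewrite lt_min r0 divr_gt0.
  - by rewrite ge_min lexx orbT.
  - move=> x; rewrite le_min => /andP[xt _]; apply: tP.
    by rewrite -ball_normE /= distrC; apply: le_lt_trans xt _; lra.
have sU x : `|x - z| <= s -> U x by move=> xs; apply: rU; exact: le_trans sr.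
have sbelow x : `|x - z| <= s -> x != z -> 0 <= w x -> v x < K.
  move=> xs xz wx; apply: below; first exact: le_trans sr.
  rewrite -subr_lt0 -/(D x) ltNge; apply/negP => Dx.
  have [_ aD] := sP x xs; have Qx := sqdist_gt0 xz.
  suff : w x < 0 by rewrite ltNge wx.
  rewrite /w mulN1r opprD addrA mulrA -[X in _ - X - _]mul1r -mulrBl.
  have : (al * D x - 1) * D x <= 0 by rewrite mulr_le0_ge0 // subr_le0 ltW.
  by move=> ?; rewrite ltrBlDr add0r; exact: le_lt_trans Qx.
pose N := [set x : 'rV[R]_n | `|x - z| <= s].
have cN : closed N by exact: closed_box.
have contN f : smooth_on U f -> forall x, N x -> {for x, continuous f}.
  by move=> sf x /sU Ux; exact: smooth_continuous sf Ux.
(* The boundary of the box, and the part of it where the barrier is not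
   negative, which lies inside the ball. *)
pose B := N `&` [set x | s <= `|x - z|].
have cB : closed B.
  apply: closedI => //.
  have -> : [set x : 'rV[R]_n | s <= `|x - z|] = ~` ball z s.
    apply/seteqP; split => x /=; rewrite -ball_normE /= distrC leNgt.
      by move=> /negP.
    by move=> /negP.
  by apply: open_closedC; apply: ball_open.
have Bz x : B x -> x != z.
  by move=> [_ /= sx]; apply/eqP => xz; move: sx; rewrite xz subrr normr0 leNgt s0.
pose P := B `&` [set x | 0 <= w x].
have cP : closed P by apply: closed_within_ge => // x [Nx _]; exact: contN.
have [e e0 eP] : exists2 e, 0 < e & forall x, P x -> v x + e * w x < K.
  have [P0|nP] := pselect (P !=set0); last first.
    by exists 1 => // x Px; case: nP; exists x.
  have kP : compact P by apply: (compact_in_box cP (z := z) (r := s)) => x [[]].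
  have wP f : smooth_on U f -> {within P, continuous f}.
    by move=> sf; apply: continuous_in_subspaceT => x; rewrite inE => -[[Nx _] _]; exact: contN.
  have [x1 Px1 vmax] := compact_EVT_max P0 kP (wP _ sv).
  have [x2 Px2 wmax] := compact_EVT_max P0 kP (wP _ sw).
  rewrite !inE in Px1 Px2.
  have vx1 : v x1 < K.
    by case: Px1 => [Bx1 wx1]; apply: sbelow => //; [exact: (proj1 Bx1)|exact: Bz].
  have wx2 : 0 <= w x2 by case: Px2.
  have w1 : 0 < w x2 + 1 by rewrite ltr_wpDl.
  exists ((K - v x1) / (w x2 + 1)); first by rewrite divr_gt0 // subr_gt0.
  move=> x Px; have Px' : x \in P by rewrite inE.
  have vx := vmax x Px'; have wx := wmax x Px'.
  have d0 : 0 < K - v x1 by rewrite subr_gt0.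
  have : (K - v x1) / (w x2 + 1) * w x < K - v x1.
    rewrite -mulrA gtr_pMr // mulrC ltr_pdivrMr // mul1r.
    by apply: le_lt_trans wx _; rewrite ltrDl.
  by move=> H; lra.
pose f x := v x + e * w x.
have sew : smooth_on U (fun x => e * w x) := smoothM oU (smooth_cst oU e) sw.
have sf : smooth_on U f := smoothD oU sv sew.
have fB x : B x -> f x < K.
  move=> Bx; have [wx|wx] := leP 0 (w x); first exact: eP.
  have : v x <= K by apply: vK; apply: sU; exact: (proj1 Bx).
  have : e * w x < 0 by rewrite pmulr_rlt0.
  by rewrite /f; move=> ? ?; lra.
have Nz : N z by rewrite /N /= subrr normr0 ltW.
have kN : compact N by apply: (compact_in_box cN (z := z) (r := s)).
have wN : {within N, continuous f}.
  by apply: continuous_in_subspaceT => x; rewrite inE; exact: contN.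
have [p Np fmax] := compact_EVT_max (ex_intro _ z Nz) kN wN.
rewrite inE in Np.
have fp : K <= f p.
  have -> : K = f z by rewrite /f vz wz mulr0 addr0.
  by apply: fmax; rewrite inE.
have ps : `|p - z| < s.
  rewrite ltNge; apply/negP => sp.
  by have := fB p (conj Np sp); rewrite ltNge fp.
have Up := sU p Np.
have pmax : \forall x \near p, f x <= f p.
  apply/nbhs_ballP; exists (s - `|p - z|); first by rewrite /= subr_gt0.
  move=> x; rewrite -ball_normE /= ltrBrDr => xp; apply: fmax; rewrite inE /N /=.
  rewrite -(subrKA p); apply: le_trans (ler_normD _ _) _.
  by rewrite distrC ltW.
have := elliptic_local_max oU b asym apos sf Up pmax.
rewrite (ellipticD oU a b sv sew Up) (ellipticZ oU a b e sw Up) leNgt => /negP; apply.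
by rewrite ltr_wpDl ?Lv // mulr_gt0 //; have [] := sP p Np.
Qed.

(** If v < K at some y near x0, let z be the point nearest to y among the points
    of a box around x0 where v = K.  Then v < K in the ball around y through z,
    and z is interior to the box since y is closer to x0 than to its boundary:
    this contradicts [hopf_touching]. *)
Theorem strong_maximum x0 : U x0 -> v x0 = K -> \forall y \near x0, v y = K.
Proof.
move=> Ux0 vx0; have [r0 r00 rU0] := open_norm oU Ux0.
pose r := r0 / 2; have r_gt0 : 0 < r by rewrite divr_gt0.
have rU x : `|x - x0| <= r -> U x.
  by move=> xr; apply: rU0; apply: le_lt_trans xr _; rewrite /r; lra.
have : \forall y \near x0, sqdist x0 y < (r / 2) ^+ 2.
  apply: (cvgr_lt _ (@continuous_sqdist _ _ x0 x0)).
  by rewrite sqdistxx exprn_gt0 // divr_gt0.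
apply: filterS => y yr; apply: contrapT => vy.
have sqC (p q : 'rV[R]_n) : sqdist p q = sqdist q p.
  by apply: eq_bigr => i _; ring.
have dist_half (p q : 'rV[R]_n) : sqdist p q < (r / 2) ^+ 2 -> `|q - p| < r / 2.
  move=> pq; have r2 : 0 <= r / 2 by rewrite divr_ge0 // ltW.
  have := le_lt_trans (sqdist_norm p q) pq.
  by rewrite ltr_pXn2r // nnegrE.
have yx0 := dist_half x0 y yr.
pose C := [set x : 'rV[R]_n | `|x - x0| <= r] `&` [set x | K <= v x].
have cC : closed C.
  apply: closed_within_ge; first exact: closed_box.
  by move=> x /= /rU Ux; exact: smooth_continuous sv Ux.
have C0 : C x0.
  by split => /=; [rewrite subrr normr0 ltW|rewrite vx0].
have kC : compact C by apply: (compact_in_box cC (z := x0) (r := r)) => x [].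
have wC : {within C, continuous (sqdist y)}.
  by apply: continuous_subspaceT => x; exact: continuous_sqdist.
have [z Cz zmin] := compact_EVT_min (ex_intro _ x0 C0) kC wC.
rewrite inE in Cz; case: Cz => zr vz.
have zx0 : sqdist y z <= sqdist y x0 by apply: zmin; rewrite inE.
have zy : `|z - y| < r / 2.
  by apply: dist_half; apply: le_lt_trans zx0 _; rewrite sqC.
have zx : `|z - x0| < r.
  rewrite -(subrKA y); apply: le_lt_trans (ler_normD _ _) _; rewrite [r]splitr.
  exact: ltrD.
pose s := r - `|z - x0|.
have s0 : 0 < s by rewrite subr_gt0.
have sbox x : `|x - z| <= s -> `|x - x0| <= r.
  rewrite /s lerBrDr => xs; rewrite -(subrKA z).
  exact: le_trans (ler_normD _ _) xs.
apply: (@hopf_touching z y s s0).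
- by move=> x /sbox; exact: rU.
- by apply/eqP; rewrite eq_le vz andbT; apply: vK; exact: rU.
- apply/eqP => zyE; move: vy; apply; rewrite -zyE.
  by apply/eqP; rewrite eq_le vz andbT; apply: vK; exact: rU.
- move=> x /sbox xr; apply: contraTT; rewrite -!leNgt => Kv.
  by apply: zmin; rewrite inE.
Qed.

End StrongMaximum.

(** * Compact steady or expanding solitons are trivial *)

Section SolitonOperator.
Variables (R : realType) (n : nat) (U : set 'rV[R]_n).
Hypothesis oU : open U.
Variables (g : 'rV[R]_n -> 'M[R]_n) (f : 'rV[R]_n -> R) (m : R).
Hypotheses (sg : forall i j, smooth_on U (fun x => g x i j))
  (gunit : forall x, U x -> g x \in unitmx) (sf : smooth_on U f).

Lemma smooth_christoffel k i j : smooth_on U (christoffel g k i j).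
Proof.
apply: (smoothM oU (smooth_cst oU _)); apply: (smooth_sum oU) => l _.
apply: (smoothM oU (smooth_invmx oU sg gunit k l)).
exact: (smoothD oU (smoothD oU (smooth_partial i (sg j l)) (smooth_partial j (sg i l)))
  (smoothN oU (smooth_partial l (sg i j)))).
Qed.

Definition principal_coef (i j : 'I_n) (x : 'rV[R]_n) : R := f x * invmx (g x) i j.

Definition drift_coef (k : 'I_n) (x : 'rV[R]_n) : R :=
  (m - 1) * (\sum_i invmx (g x) i k * partial i f x)
  - f x * \sum_i \sum_j invmx (g x) i j * christoffel g k i j x.

Lemma smooth_principal i j : smooth_on U (principal_coef i j).
Proof. exact: (smoothM oU sf (smooth_invmx oU sg gunit i j)). Qed.

Lemma smooth_drift k : smooth_on U (drift_coef k).
Proof.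
apply: (smoothD oU).
  apply: (smoothM oU (smooth_cst oU _)); apply: (smooth_sum oU) => i _.
  exact: (smoothM oU (smooth_invmx oU sg gunit i k) (smooth_partial i sf)).
apply: (smoothN oU); apply: (smoothM oU sf).
apply: (smooth_sum oU) => i _; apply: (smooth_sum oU) => j _.
exact: (smoothM oU (smooth_invmx oU sg gunit i j) (smooth_christoffel k i j)).
Qed.

(** The part of the first integral that contains derivatives is a linear
    operator without zeroth order term, applied to f, with coefficients that
    depend on f itself. *)
Lemma elliptic_soliton x : U x ->
  elliptic principal_coef drift_coef f x =
  f x * laplacian g f x + (m - 1) * sqnorm g (gradient g f) x.
Proof.
move=> Ux; rewrite sqnorm_gradient; last exact: gunit.
pose h i j := invmx (g x) i j.
have lapE : laplacian g f x = \sum_i \sum_j h i j * partial i (partial j f) x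
   - \sum_k (\sum_i \sum_j h i j * christoffel g k i j x) * partial k f x.
  have -> : \sum_k (\sum_i \sum_j h i j * christoffel g k i j x) * partial k f x =
      \sum_i \sum_j h i j * \sum_k christoffel g k i j x * partial k f x.
    transitivity (\sum_k \sum_i \sum_j h i j * christoffel g k i j x * partial k f x).
      apply: eq_bigr => k _; rewrite mulr_suml; apply: eq_bigr => i _.
      by rewrite mulr_suml.
    rewrite exchange_big; apply: eq_bigr => i _ /=.
    rewrite exchange_big; apply: eq_bigr => j _ /=.
    by rewrite mulr_sumr; apply: eq_bigr => k _; exact/esym/mulrA.
  rewrite -sumrB; apply: eq_bigr => i _; rewrite -sumrB; apply: eq_bigr => j _.
  by rewrite -mulrBr; congr (_ * _); rewrite mxE.
rewrite lapE /elliptic.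
have gradE : \sum_i \sum_j invmx (g x) i j * partial i f x * partial j f x =
    \sum_k (\sum_i h i k * partial i f x) * partial k f x.
  by rewrite exchange_big; apply: eq_bigr => k _ /=; rewrite mulr_suml.
have driftE : \sum_k drift_coef k x * partial k f x =
  (m - 1) * (\sum_k (\sum_i h i k * partial i f x) * partial k f x)
  - f x * (\sum_k (\sum_i \sum_j h i j * christoffel g k i j x) * partial k f x).
  rewrite !mulr_sumr -sumrB; apply: eq_bigr => k _; rewrite mulrBl.
  by congr (_ - _); exact/esym/mulrA.
have prinE : \sum_i \sum_j principal_coef i j x * partial i (partial j f) x =
   f x * (\sum_i \sum_j h i j * partial i (partial j f) x).
  rewrite mulr_sumr; apply: eq_bigr => i _; rewrite mulr_sumr.
  by apply: eq_bigr => j _; exact/esym/mulrA.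
rewrite gradE driftE prinE.
ring.
Qed.

Lemma principal_posdef x : U x -> (g x)^T = g x ->
    (forall v : 'rV[R]_n, v != 0 -> 0 < (v *m g x *m v^T) 0 0) -> 0 < f x ->
  posdef (fun i j => principal_coef i j x).
Proof.
move=> Ux gs gp fx v v0.
have -> : quad (fun i j => principal_coef i j x) v = f x * quad (fun i j => invmx (g x) i j) v.
  rewrite /quad mulr_sumr; apply: eq_bigr => i _; rewrite mulr_sumr.
  by apply: eq_bigr => j _; rewrite /principal_coef mulrCA.
by rewrite mulr_gt0 //; exact: (posdef_invmx gs (gunit Ux) gp).
Qed.

Lemma principal_sym i j x : U x -> (g x)^T = g x ->
  principal_coef i j x = principal_coef j i x.
Proof.
move=> Ux gs; rewrite /principal_coef; congr (_ * _).
by rewrite -{1}gs -trmx_inv mxE.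
Qed.

End SolitonOperator.

Section Triviality.
Variables (R : realType) (n : nat) (M : smooth_manifold R n).
Variables (g : riemannian_metric M) (u : M -> R).
Hypotheses (su : smooth_fun u) (u_pos : forall p : M, 0 < u p).
Variables (m lambda : R).
Local Notation chrt := (@chart_of R n M).

Lemma smooth_fun_continuous : continuous u.
Proof.
move=> p; have [a da] := atlas_cover p.
apply/cvgrPdist_le => e e0.
have ca : {for Defs.coord (chrt a) p, continuous (local_rep a u)}.
  exact: (smooth_continuous (@su a) (coordP da)).
have /cvgrPdist_le/(_ e e0) H := ca.
have := near_chart da H; apply: filterS => q [dq].
by rewrite /local_rep !coordK.
Qed.

Lemma constant_soliton_trivial (c : R) : (forall p, u p = c) -> trivial_soliton g u.
Proof.
move=> uc; exists 0 => a p dp /=.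
have grad0 y k : gradient (g a) (local_rep a u) y 0 k = 0.
  have -> : local_rep a u = cst c by apply/funext => x; exact: uc.
  by rewrite mxE big1 // => l _; rewrite partial_cst mulr0.
have dgrad0 i k x : partial i (fun y => gradient (g a) (local_rep a u) y 0 k) x = 0.
  have -> : (fun y => gradient (g a) (local_rep a u) y 0 k) = (fun=> 0).
    by apply/funext => y; exact: grad0.
  exact: partial_cst.
apply/matrixP => i j; rewrite [LHS]mxE [RHS]mxE mul0r big1 // => k _.
by rewrite grad0 !dgrad0 mul0r !mulr0 !addr0.
Qed.

Hypotheses (m0 : m != 0) (sol : gradient_soliton g u m lambda) (lambda_le0 : lambda <= 0)
  (cM : compact [set: M]).

(** The maximum of u bounds mu, which makes -u a subsolution; the strong maximum
    principle is then used at the minimum of u. *)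
Theorem compact_soliton_constant (p0 : M) : exists c, forall p, u p = c.
Proof.
have [mu muE] := first_integral_constant su u_pos m0 sol.
have cu : {within [set: M], continuous u}.
  by apply: continuous_subspaceT; exact: smooth_fun_continuous.
have [p1 _ u_max] := compact_EVT_max (ex_intro _ p0 I) cM cu.
have [q1 _ u_min] := compact_EVT_min (ex_intro _ p0 I) cM cu.
have {}u_max p : u p <= u p1 by apply: u_max; rewrite inE.
have {}u_min p : u q1 <= u p by apply: u_min; rewrite inE.
pose A a := principal_coef (g a) (local_rep a u).
pose B a := drift_coef (g a) (local_rep a u) m.
have gu a x : cod (chrt a) x -> g a x \in unitmx by exact: metric_unit.
have sgm a := @metric_smooth _ _ _ g a.
have oc a := @open_cod _ _ _ (chrt a).
have A_sym a i j x : cod (chrt a) x -> A a i j x = A a j i x.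
  by move=> cx; apply: (principal_sym _ _ _ cx); exact: Defs.metric_sym.
have A_pos a x : cod (chrt a) x -> posdef (fun i j => A a i j x).
  move=> cx; apply: (principal_posdef (gu a) cx).
  - exact: Defs.metric_sym.
  - exact: metric_posdef.
  - exact: u_pos.
have LE a x : cod (chrt a) x ->
    elliptic (A a) (B a) (local_rep a u) x = mu - lambda * local_rep a u x ^+ 2.
  move=> cx; rewrite (elliptic_soliton (local_rep a u) m (gu a) cx).
  have := muE _ _ (paramP cx); rewrite /laplacian_at /gradient_sqnorm_at paramK // => <-.
  by rewrite /local_rep; ring.
have mu_le : mu <= lambda * u p1 ^+ 2.
  have [a da] := atlas_cover p1.
  have := elliptic_local_max (oc a) (B a) (A_sym a) (A_pos a) (@su a) (coordP da).
  rewrite LE; last exact: coordP.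
  rewrite subr_le0 /local_rep coordK //; apply.
  by apply: filterE => x; exact: u_max.
have L_le0 a x : cod (chrt a) x -> elliptic (A a) (B a) (local_rep a u) x <= 0.
  move=> cx; rewrite LE // subr_le0; apply: (le_trans mu_le).
  apply: ler_wnM2l => //; apply: lerXn2r; rewrite ?nnegrE.
  - exact: ltW (u_pos _).
  - exact: ltW (u_pos _).
  - exact: u_max.
exists (u q1) => p.
apply: (@connected_clopen_ind M [set p | u p = u q1] q1 (@space_connected _ _ M)) => // {}p.
have [up|up] := eqVneq (u p) (u q1); last first.
  have : \forall q \near p, u q1 < u q.
    apply: (cvgr_gt _ (@smooth_fun_continuous p)).
    by rewrite lt_neqAle eq_sym up u_min.
  apply: filterS => q uq /=; split=> E; first by rewrite E ltxx in uq.
  by rewrite E eqxx in up.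
have [a da] := atlas_cover p.
have sN : smooth_on (cod (chrt a)) (fun x => -1 * local_rep a u x).
  exact: (smoothM (oc a) (smooth_cst (oc a) (-1)) (@su a)).
have L_ge0 x : cod (chrt a) x ->
    0 <= elliptic (A a) (B a) (fun x => -1 * local_rep a u x) x.
  move=> cx; rewrite (ellipticZ (oc a) (A a) (B a) (-1) (@su a) cx) mulN1r oppr_ge0.
  exact: L_le0.
have le_K x : cod (chrt a) x -> -1 * local_rep a u x <= - u q1.
  by move=> _; rewrite mulN1r lerN2; exact: u_min.
have at_K : -1 * local_rep a u (Defs.coord (chrt a) p) = - u q1.
  by rewrite mulN1r /local_rep coordK // up.
have near_min := strong_maximum (oc a) (A_sym a) (A_pos a)
  (smooth_principal (oc a) (sgm a) (gu a) (@su a))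
  (smooth_drift (oc a) m (sgm a) (gu a) (@su a)) sN L_ge0 le_K (coordP da) at_K.
have := near_chart da near_min; apply: filterS => q [dq].
by rewrite mulN1r /local_rep coordK // => /oppr_inj /= ->.
Qed.

End Triviality.

Lemma compact_soliton_trivial (R : realType) (n : nat) (M : smooth_manifold R n)
    (g : riemannian_metric M) (u : M -> R) (m lambda : R) :
    smooth_fun u -> (forall p : M, 0 < u p) -> m != 0 -> lambda <= 0 ->
    compact [set: M] -> gradient_soliton g u m lambda ->
  trivial_soliton g u.
Proof.
move=> su u_pos m0 l0 cM sol.
have [[p0 _]|M0] := pselect ([set: M] !=set0); last first.
  by exists 0 => a p; case: M0; exists p.
have [c uc] := compact_soliton_constant su u_pos m0 sol l0 cM p0.
exact: (constant_soliton_trivial g uc).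
Qed.

Theorem theorem2 (R : realType) (n : nat) (hn : (3 <= n)%N)
    (M : smooth_manifold R n) (g : riemannian_metric M)
    (u : M -> R) (u_smooth : smooth_fun u) (u_pos : forall p : M, 0 < u p)
    (m : R) (hm : m != 0) (lambda : R) :
  (gradient_soliton g u m lambda ->
     exists mu : R, forall (p : M) (a : atlas M), dom (chart_of a) p ->
       lambda * u p ^+ 2 + u p * laplacian_at g u a p
       + (m - 1) * gradient_sqnorm_at g u a p = mu)
  /\
  (compact [set: M] -> gradient_soliton g u m lambda ->
     lambda = 0 \/ lambda < 0 ->
     trivial_soliton g u).
Proof.
split=> [sol|cM sol lambda0]; first exact: first_integral_constant.
apply: (compact_soliton_trivial u_smooth u_pos hm _ cM sol).
by case: lambda0 => [->|/ltW].
Qed.
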